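(* Let $\Delta t>0$, $t_n=n\Delta t$, and let $v_h^0\in W_h$, $k_h^0$ be given. Suppose $v_h^{n+1}\in W_h$, $q_h^{n+1}\in Q_h$, $k_h^{n+1}\in\mathbb{R}$, $n=0,\dots,N-1$, satisfy for all $w_h\in W_h$, $p_h\in Q_h$: \[ \Big(\frac{v_h^{n+1}-v_h^n}{\Delta t},w_h\Big)+(\nu+\mu\tau k_h^n)(\nabla v_h^{n+1},\nabla w_h)+b(v_h^n,v_h^{n+1},w_h)-(\nabla\cdot w_h,q_h^{n+1})=(f^{n+1},w_h), \] \[ (\nabla\cdot v_h^{n+1},p_h)=0,\qquad \frac{k_h^{n+1}-k_h^n}{\Delta t}+\frac{\sqrt2}{2}\tau^{-1}k_h^{n+1}=\frac{1}{|\Omega|}\int_\Omega\mu\tau k_h^n|\nabla v_h^{n+1}|^2dx . \] Then, with a constant $C$ independent of $\Delta t$ and $N$, \[ \|v_h^N\|^2+2|\Omega|k_h^N+\Delta t\sum_{n=0}^{N-1}\Big(\nu\|\nabla v_h^{n+1}\|^2+\sqrt2\tau^{-1}|\Omega|k_h^{n+1}\Big)+\sum_{n=0}^{N-1}\|v_h^{n+1}-v_h^n\|^2\le\sum_{n=0}^{N-1}C\Delta t\|f^{n+1}\|^2+\|v_h^0\|^2+2|\Omega|k_h^0 . \]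
   Context: $\Omega\subset\mathbb{R}^d$ ($d=2,3$) is a bounded domain with measure $|\Omega|$; $(\cdot,\cdot)$, $\|\cdot\|$ are the $L^2(\Omega)$ inner product and norm; $\nu,\mu,\tau>0$ are constants; $f^{n+1}=f(\cdot,t_{n+1})$. $W_h\subset H_0^1(\Omega)^d$ and $Q_h\subset L_0^2(\Omega)$ are continuous piecewise polynomial finite element spaces of degree $r\ge2$ and $r-1$ on a regular quasi-uniform triangulation, satisfying the discrete inf-sup condition. The trilinear form is $b(u,v,w)=\tfrac12((u\cdot\nabla)v,w)-\tfrac12((u\cdot\nabla)w,v)$. *)

(* Defs.v *)
From HB Require Import structures.
From mathcomp Require Import all_boot all_order all_algebra.
From mathcomp Require Import all_classical all_reals all_analysis.
Set Implicit Arguments. Unset Strict Implicit. Unset Printing Implicit Defensive.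
Import Order.TTheory GRing.Theory Num.Theory.
Import numFieldNormedType.Exports.
Local Open Scope classical_set_scope.
Local Open Scope ring_scope.

Section FEM.
Variable R : realType.

(* Lebesgue integration on R^n, realised as the iterated one-dimensional    *)
(* Lebesgue integral (Fubini); points of R^n are row vectors 'rV[R]_n.      *)

Definition slice n (g : 'rV[R]_n.+1 -> R) (x : R) : 'rV[R]_n -> R :=
  fun y => g (row_mx (\row_(_ < 1) x) y).

Fixpoint iint (n : nat) : ('rV[R]_n -> R) -> R :=
  match n with
  | 0 => fun g => g 0
  | n'.+1 => fun g =>
      Rintegral (@lebesgue_measure R) setT (fun x => iint (slice g x))
  end.

Fixpoint iintegrable (n : nat) : ('rV[R]_n -> R) -> Prop :=
  match n with
  | 0 => fun _ => True
  | n'.+1 => fun g =>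
      {ae (@lebesgue_measure R), forall x, iintegrable (slice g x)} /\
      (@lebesgue_measure R).-integrable setT (fun x => (iint (slice g x))%:E)
  end.

Variable d : nat.
Local Notation pt := 'rV[R]_d.

Definition intO (Om : set pt) (g : pt -> R) : R := iint (fun x => g x * \1_Om x).
Definition measO (Om : set pt) : R := intO Om (fun _ => 1).

Definition L2O (Om : set pt) (g : pt -> R) : Prop :=
  iintegrable (fun x => g x * \1_Om x) /\ iintegrable (fun x => g x ^+ 2 * \1_Om x).

Definition comp (u : pt -> pt) (i : 'I_d) : pt -> R := fun x => u x 0 i.

Definition L2vecO (Om : set pt) (u : pt -> pt) : Prop := forall i, L2O Om (comp u i).

Definition dotv (a b : pt) : R := \sum_(i < d) a 0 i * b 0 i.

Definition ipO (Om : set pt) (u w : pt -> pt) : R := intO Om (fun x => dotv (u x) (w x)).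
Definition nsqO (Om : set pt) (u : pt -> pt) : R := ipO Om u u.

Definition pd (g : pt -> R) (j : 'I_d) : pt -> R := 'D_(delta_mx 0 j) g.

Definition gradip (u w : pt -> pt) (x : pt) : R :=
  \sum_(i < d) \sum_(j < d) pd (comp u i) j x * pd (comp w i) j x.

Definition gipO (Om : set pt) (u w : pt -> pt) : R := intO Om (gradip u w).
Definition gnsqO (Om : set pt) (u : pt -> pt) : R := gipO Om u u.

Definition divg (u : pt -> pt) (x : pt) : R := \sum_(i < d) pd (comp u i) i x.

Definition conv (u v : pt -> pt) (x : pt) : pt :=
  \row_(i < d) \sum_(j < d) u x 0 j * pd (comp v i) j x.

Definition btri (Om : set pt) (u v w : pt -> pt) : R :=
  2^-1 * ipO Om (conv u v) w - 2^-1 * ipO Om (conv u w) v.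

Definition bounded_domain (Om : set pt) : Prop :=
  open Om /\ connected Om /\ Om !=set0 /\ bounded_set Om.

Definition hull (P : seq pt) : set pt :=
  [set x | exists lam : nat -> R, (forall i, 0 <= lam i) /\
     \sum_(i < size P) lam i = 1 /\ x = \sum_(i < size P) lam i *: nth 0 P i].

Definition vertices (a : 'I_d.+1 -> pt) : seq pt := [seq a i | i <- enum 'I_d.+1].
Definition simplex (a : 'I_d.+1 -> pt) : set pt := hull (vertices a).
Definition nondegenerate (a : 'I_d.+1 -> pt) : Prop :=
  \det (\matrix_(i < d) (a (lift ord0 i) - a ord0)) != 0.

Definition triangulation (Om : set pt) (m : nat) (K : 'I_m -> 'I_d.+1 -> pt) : Prop :=
  (forall e, nondegenerate (K e)) /\
  [set x | exists e, simplex (K e) x] = closure Om /\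
  (forall e e', e != e' -> exists P : seq pt,
      (forall p, p \in P -> p \in vertices (K e) /\ p \in vertices (K e')) /\
      simplex (K e) `&` simplex (K e') = hull P).

Definition poly_le (r : nat) (p : pt -> R) : Prop :=
  exists s : seq ({ffun 'I_d -> nat} * R),
    all (fun mc : {ffun 'I_d -> nat} * R => (\sum_(i < d) mc.1 i <= r)%N) s /\
    forall x, p x = \sum_(mc <- s) mc.2 * \prod_(i < d) x 0 i ^+ (mc.1 : {ffun 'I_d -> nat}) i.

Definition pw_poly m (K : 'I_m -> 'I_d.+1 -> pt) (r : nat) (g : pt -> R) : Prop :=
  forall e, exists p, poly_le r p /\ forall x, simplex (K e) x -> g x = p x.

(* W_h: continuous piecewise P_r vector fields vanishing on the boundary
   (extended by zero outside Omega), a subspace of H_0^1(Omega)^d *)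
Definition Wh (Om : set pt) m (K : 'I_m -> 'I_d.+1 -> pt) (r : nat) : set (pt -> pt) :=
  [set v : pt -> pt | continuous v /\ (forall x, ~ Om x -> v x = 0) /\
           forall i, pw_poly K r (comp v i)].

Definition Qh (Om : set pt) m (K : 'I_m -> 'I_d.+1 -> pt) (r : nat) : set (pt -> R) :=
  [set q : pt -> R | {within closure Om, continuous q} /\ pw_poly K r.-1 q /\ intO Om q = 0].

(* discrete inf-sup condition:
   inf_{q in Q} sup_{w in W, w <> 0} (div w, q) / (||grad w|| ||q||) >= beta > 0 *)
Definition inf_sup (Om : set pt) (W : set (pt -> pt)) (Q : set (pt -> R)) : Prop :=
  exists beta : R, 0 < beta /\
    forall q, Q q -> forall c : R, c < beta * Num.sqrt (intO Om (fun x => q x ^+ 2)) ->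
      exists w, W w /\ 0 < gnsqO Om w /\
        c * Num.sqrt (gnsqO Om w) < intO Om (fun x => divg w x * q x).

End FEM.

(* Main.v *)
Require Import Defs.
From HB Require Import structures.
From mathcomp Require Import all_boot all_order all_algebra.
From mathcomp Require Import all_classical all_reals all_analysis.
From mathcomp Require Import measurable_realfun ring lra.
Set Implicit Arguments. Unset Strict Implicit. Unset Printing Implicit Defensive.
Import Order.TTheory GRing.Theory Num.Theory.
Import numFieldNormedType.Exports.
Local Open Scope classical_set_scope.
Local Open Scope ring_scope.

(** Testing the momentum equation with w = v^{n+1} kills the convection and the
    pressure terms. Adding 2 |Omega| times the equation for k cancels the
    turbulent dissipation whatever the sign of k^n, and
    2 (v^{n+1} - v^n, v^{n+1}) = |v^{n+1}|^2 - |v^n|^2 + |v^{n+1} - v^n|^2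
    makes the sum telescope. The forcing is absorbed by Young's inequality and
    the Poincare inequality, which gives C = 4 M^2 / nu when Omega lies in the
    cube [-M, M]^d.

    The analytic content is the Poincare inequality for the iterated integral.
    Functions of W_h are piecewise polynomial and continuous, hence Lipschitz,
    and on each line they are differentiable off finitely many points. On a
    line parallel to the last axis, 0 = int ((s - a) phi^2)' gives
    int phi^2 <= 4 M^2 int phi'^2, and this integrates over the other
    coordinates. Measurability of gradients is never established: the integral
    of the library is a lower integral, which is monotone and homogeneous on
    arbitrary bounded functions with bounded support. *)

(** * Integrals of possibly non-measurable functions *)

Section lower_integral.
Context d (T : measurableType d) (R : realType).
Variable mu : {measure set T -> \bar R}.
Import HBNNSimple.

(* The library's integral of a nonnegative function is a lower integral, so no
   measurability is needed for monotonicity. *)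
Lemma ae_ge0_le_integral_lower (f g : T -> \bar R) :
  (forall x, 0 <= f x)%E -> (forall x, 0 <= g x)%E ->
  {ae mu, forall x, (f x <= g x)%E} ->
  (\int[mu]_x f x <= \int[mu]_x g x)%E.
Proof.
move=> f0 g0 [N [mN N0 fgN]].
rewrite [leRHS]ge0_integralTE// [leLHS]ge0_integralTE//.
apply: ge_ereal_sup => _ [h hf <-].
have mCN : measurable (~` N) by exact: measurableC.
(* Cutting a simple function below [f] off on the null set [N] puts it below [g] everywhere and
   leaves its integral unchanged. *)
suff -> : sintegral mu h = sintegral mu (proj_nnsfun h mCN).
  apply: ereal_sup_ubound; exists (proj_nnsfun h mCN) => //= x.
  rewrite mindicE; have [xN|xN] := boolP (x \in ~` N).
    rewrite mulr1; apply: (le_trans (hf x)); apply: contrapT => xfg.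
    by move: xN; rewrite inE; apply; exact: fgN.
  by rewrite mulr0 g0.
have -> : sintegral mu (proj_nnsfun h mCN) = sintegral mu (h \_ (~` N)).
  by rewrite -mrestrict.
rewrite -integral_nnsfun//.
have -> : sintegral mu h = sintegral mu (h \_ setT) by rewrite patch_setT.
rewrite -integral_nnsfun//.
rewrite -setTD; apply: ge0_negligible_integral => //.
- exact/measurable_EFinP.
- by move=> x _; rewrite lee_fin.
Qed.

Lemma ae_le_integral_lower (f g : T -> \bar R) :
  {ae mu, forall x, (f x <= g x)%E} -> (\int[mu]_x f x <= \int[mu]_x g x)%E.
Proof.
move=> fg; rewrite [leLHS]integralE [leRHS]integralE; apply: leeB;
  apply: ae_ge0_le_integral_lower => //; apply: filterS fg => x fgx.
- by rewrite !funeposE ge_max !le_max fgx lexx orbT.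
- by rewrite !funenegE ge_max !le_max leeN2 fgx lexx orbT.
Qed.

Lemma ae_eq_integral_lower (f g : T -> \bar R) :
  {ae mu, forall x, f x = g x} -> (\int[mu]_x f x = \int[mu]_x g x)%E.
Proof.
move=> fg; apply/eqP; rewrite eq_le; apply/andP; split;
  by apply: ae_le_integral_lower; apply: filterS fg => x ->.
Qed.

(** Scaling by [r] sends simple functions below [f] to simple functions below [r f], so the suprema
    compare without any measurability of [f]. *)
Lemma le_integral_lowerZ (r : R) (f : T -> \bar R) : 0 < r ->
  (forall x, 0 <= f x)%E ->
  (r%:E * \int[mu]_x f x <= \int[mu]_x (r%:E * f x))%E.
Proof.
move=> r0 f0.
have rf0 x : (0 <= r%:E * f x)%E by rewrite mule_ge0// lee_fin ltW.
rewrite -lee_pdivlMl// [leLHS]ge0_integralTE// [in leRHS]ge0_integralTE//.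
apply: ge_ereal_sup => _ [h hf <-].
rewrite lee_pdivlMl//.
apply: ereal_sup_ubound.
exists (scale_nnsfun h (ltW r0)) => //=.
  by move=> x; rewrite EFinM lee_pmul2l// lte_fin.
by rewrite -sintegralrM.
Qed.

Lemma ge0_integral_lowerZ (r : R) (f : T -> \bar R) : 0 < r ->
  (forall x, 0 <= f x)%E ->
  (\int[mu]_x (r%:E * f x) = r%:E * \int[mu]_x f x)%E.
Proof.
move=> r0 f0; apply/eqP; rewrite eq_le le_integral_lowerZ// andbT.
(* The reverse inequality is the lemma just proved, applied to [r^-1] and [r f]. *)
have ri0 : 0 < r^-1 by rewrite invr_gt0.
have := @le_integral_lowerZ r^-1 (fun x => r%:E * f x)%E ri0.
rewrite lee_pdivrMl//. 
under [X in (_ <= _ * X)%E]eq_integral.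
  by move=> x _; rewrite muleA -EFinM mulVf ?gt_eqF// mul1e; over.
by apply => x; rewrite mule_ge0// lee_fin ltW.
Qed.

End lower_integral.

Section lower_Rintegral.
Context d (T : measurableType d) (R : realType).
Variable mu : {measure set T -> \bar R}.

(** Negation swaps the positive and negative parts. The identity survives infinite integrals because
    [fine] sends both infinities to 0. *)
Lemma Rintegral_lowerN (f : T -> R) :
  Rintegral mu setT (fun x => - f x) = - Rintegral mu setT f.
Proof.
rewrite /Rintegral [in LHS]integralE [in RHS]integralE.
set A := (\int[mu]_x _)%E; set B := (\int[mu]_x _)%E.
set A' := (\int[mu]_x _)%E; set B' := (\int[mu]_x _)%E.
have -> : A = B' by apply: eq_integral => x _; rewrite funeposE funenegE.
have -> : B = A'.
  by apply: eq_integral => x _; rewrite funeposE funenegE -EFinN opprK.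
have : (0 <= A')%E by apply: integral_ge0.
have : (0 <= B')%E by apply: integral_ge0.
by case: A' B' => [a| |] [b| |]//= _ _; rewrite ?oppr0// opprB.
Qed.

Lemma Rintegral_lowerZ (r : R) (f : T -> R) :
  Rintegral mu setT (fun x => r * f x) = r * Rintegral mu setT f.
Proof.
have pos (s : R) : 0 < s ->
    Rintegral mu setT (fun x => s * f x) = s * Rintegral mu setT f.
  move=> s0; rewrite /Rintegral [in LHS]integralE [in RHS]integralE.
  have maxM (y : R) : (maxe (s%:E * y%:E) 0 = s%:E * maxe y%:E 0)%E.
    by rewrite -EFinM -!EFin_max -EFinM maxr_pMr ?ltW// mulr0.
  under [X in fine (X - _)%E]eq_integral do rewrite funeposE EFinM maxM.
  under [X in fine (_ - X)%E]eq_integral do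
    rewrite funenegE -EFinN -mulrN EFinM maxM.
  rewrite !ge0_integral_lowerZ//; try by move=> x; rewrite le_max lexx orbT.
  set A := (\int[mu]_x _)%E; set B := (\int[mu]_x _)%E.
  set A' := (\int[mu]_x _)%E; set B' := (\int[mu]_x _)%E.
  have -> : A = A' by apply: eq_integral => x _; rewrite funeposE.
  have -> : B = B' by apply: eq_integral => x _; rewrite funenegE.
  have : (0 <= A')%E by apply: integral_ge0.
  have : (0 <= B')%E by apply: integral_ge0.
  case: A' B' => [a| |] [b| |]//= _ _; rewrite -?EFinM/= ?gt0_muley ?lte_fin//=
    ?mulr0// mulrBr//.
have [r0|r0|->] := ltgtP r 0; last 2 first.
- exact: pos.
- by rewrite mul0r; under eq_Rintegral do rewrite mul0r; rewrite Rintegral_cst// mul0r.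
have r0' : 0 < - r by rewrite oppr_gt0.
apply: oppr_inj; rewrite -Rintegral_lowerN -mulNr -pos//.
by apply: eq_Rintegral => x _; rewrite mulNr.
Qed.

Lemma ae_eq_Rintegral_lower (f g : T -> R) : {ae mu, forall x, f x = g x} ->
  Rintegral mu setT f = Rintegral mu setT g.
Proof.
move=> fg; rewrite /Rintegral; congr fine; apply: ae_eq_integral_lower.
by apply: filterS fg => x ->.
Qed.

(** Since [fine] is not monotone at infinite values, the integrable bound [D] serves to keep both
    lower integrals finite. *)
Lemma ae_le_Rintegral_lower (D f g : T -> R) : mu.-integrable setT (EFin \o D) ->
  {ae mu, forall x, `|f x| <= D x} -> {ae mu, forall x, `|g x| <= D x} ->
  {ae mu, forall x, f x <= g x} ->
  Rintegral mu setT f <= Rintegral mu setT g.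
Proof.
move=> iD fD gD fg.
have finD : (\int[mu]_x (EFin \o D) x \is a fin_num)%E by exact: integrable_fin_num.
have finND : (\int[mu]_x (\- (EFin \o D)) x \is a fin_num)%E.
  by apply: integrable_fin_num => //; exact: integrableN.
have fin (h : T -> R) : {ae mu, forall x, `|h x| <= D x} ->
    (\int[mu]_x (h x)%:E \is a fin_num)%E.
  move=> hD; rewrite fin_numE; apply/andP; split.
    rewrite -ltNye; apply: (@lt_le_trans _ _ (\int[mu]_x (\- (EFin \o D)) x)%E).
      by rewrite ltNye; move: finND; rewrite fin_numE => /andP[].
    apply: ae_le_integral_lower; apply: filterS hD => x.
    by rewrite /= lee_fin ler_norml => /andP[].
  rewrite -ltey; apply: (@le_lt_trans _ _ (\int[mu]_x (EFin \o D) x)%E).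
    apply: ae_le_integral_lower; apply: filterS hD => x.
    by rewrite /= lee_fin ler_norml => /andP[].
  by rewrite ltey; move: finD; rewrite fin_numE => /andP[].
apply: fine_le; [exact: fin|exact: fin|].
by apply: ae_le_integral_lower; apply: filterS fg => x; rewrite lee_fin.
Qed.

End lower_Rintegral.

#[local] Instance ae_lebesgue_filter (R : realType) :
  Filter (almost_everywhere (@lebesgue_measure R)) :=
  ae_filter_ringOfSetsType (@lebesgue_measure R).

(** * Iterated integrals: linearity and monotonicity up to null sets *)

Section iterated.
Variable R : realType.
Local Notation mu := (@lebesgue_measure R).

(* Lebesgue measure is restricted to Borel sets, hence not complete, so sums of
   [iintegrable] functions need not be [iintegrable]; this weakening, which
   requires measurability up to a null set only, is stable under sums. *)
Fixpoint ae_iintegrable (n : nat) : ('rV[R]_n -> R) -> Prop :=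
  match n with
  | 0 => fun _ => True
  | n'.+1 => fun g =>
      {ae mu, forall x, ae_iintegrable (slice g x)} /\
      exists I : R -> R, mu.-integrable setT (EFin \o I) /\
        {ae mu, forall x, iint (slice g x) = I x}
  end.

Lemma ae_iintegrableW n (g : 'rV[R]_n -> R) : iintegrable g -> ae_iintegrable g.
Proof.
elim: n g => [//|n IH] g [sg ig]; split.
  by apply: filterS sg => x; exact: IH.
by exists (fun x => iint (slice g x)); split => //; exact: aeW.
Qed.

Lemma iintZ n c (g : 'rV[R]_n -> R) : iint (fun x => c * g x) = c * iint g.
Proof.
elim: n g => [//|n IH] g /=; rewrite -Rintegral_lowerZ.
by apply: eq_Rintegral => x _; rewrite -IH.
Qed.

Lemma ae_iintegrableZ n c (g : 'rV[R]_n -> R) : ae_iintegrable g ->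
  ae_iintegrable (fun x => c * g x).
Proof.
elim: n g => [//|n IH] g [sg [I [iI gI]]]; split.
  by apply: filterS sg => x /IH.
exists (fun x => c * I x); split.
  rewrite (_ : _ \o _ = (fun x => c%:E * (EFin \o I) x)%E)//.
  exact: integrableZl.
by apply: filterS gI => x <-; rewrite -iintZ.
Qed.

(** Both conclusions go through one induction: integrability in the outer variable requires
    additivity of the integral on almost every slice. *)
Lemma ae_iintegrableD n (g h : 'rV[R]_n -> R) :
  ae_iintegrable g -> ae_iintegrable h ->
  ae_iintegrable (fun x => g x + h x) /\
  iint (fun x => g x + h x) = iint g + iint h.
Proof.
elim: n g h => [//|n IH] g h [sg [I [iI gI]]] [sh [J [iJ hJ]]].
have E : {ae mu, forall x, iint (slice (fun x => g x + h x) x) = I x + J x}.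
  near=> x; rewrite -(near gI x)// -(near hJ x)//.
  by apply: (IH _ _ _ _).2; [apply: (near sg x)|apply: (near sh x)].
split.
  split; first by apply: filterS2 sg sh => x sgx shx; exact: (IH _ _ sgx shx).1.
  exists (fun x => I x + J x); split => //.
  rewrite (_ : _ \o _ = (EFin \o I) \+ (EFin \o J))%E//.
  exact: integrableD.
rewrite /= (ae_eq_Rintegral_lower gI) (ae_eq_Rintegral_lower hJ).
by rewrite (ae_eq_Rintegral_lower E) RintegralD.
Unshelve. all: by end_near. Qed.

Lemma iint0 n : iint (fun _ : 'rV[R]_n => 0) = 0.
Proof.
rewrite -[RHS](mul0r (iint (fun _ : 'rV[R]_n => 0))) -iintZ.
by congr iint; apply/funext => x; rewrite mul0r.
Qed.

Lemma ae_iintegrable0 n : ae_iintegrable (fun _ : 'rV[R]_n => 0).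
Proof.
elim: n => [//|n IH]; split; first exact: aeW.
exists (fun=> 0); split; first exact: integrable0.
by apply: aeW => x; rewrite [LHS]iint0.
Qed.

Lemma ae_iintegrable_sum n (I : Type) (s : seq I) (g : I -> 'rV[R]_n -> R) :
  (forall i, ae_iintegrable (g i)) -> ae_iintegrable (fun x => \sum_(i <- s) g i x).
Proof.
move=> ig; elim: s => [|i s IH].
  rewrite (_ : (fun _ => _) = fun=> 0); first exact: ae_iintegrable0.
  by apply/funext => x; rewrite big_nil.
rewrite (_ : (fun _ => _) = fun x => g i x + \sum_(i <- s) g i x).
  exact: (ae_iintegrableD (ig i) IH).1.
by apply/funext => x; rewrite big_cons.
Qed.

(** Compare [g] with [D] and [- D]. Monotonicity is a hypothesis so that the bound can be used in
    dimension [n] inside the induction that proves [iint_le]. *)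
Let norm_iint_le_mono n (D g : 'rV[R]_n -> R) :
  (forall f h : 'rV[R]_n -> R, (forall x, `|f x| <= D x) ->
    (forall x, `|h x| <= D x) -> (forall x, f x <= h x) -> iint f <= iint h) ->
  (forall x, `|g x| <= D x) -> `|iint g| <= iint D.
Proof.
move=> mono gD; have D0 x : 0 <= D x by exact: le_trans (gD x).
rewrite ler_norml.
have -> : - iint D = iint (fun y => -1 * D y) by rewrite iintZ mulN1r.
have gD' x : - D x <= g x <= D x by rewrite -ler_norml.
apply/andP; split; apply: mono => x //; rewrite ?mulN1r ?normrN ?ger0_norm//.
  by case/andP: (gD' x).
by case/andP: (gD' x).
Qed.

(* Neither [g] nor [h] is assumed measurable: domination alone keeps the lower
   integrals finite. *)
Lemma iint_le n (D g h : 'rV[R]_n -> R) : ae_iintegrable D ->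
  (forall x, `|g x| <= D x) -> (forall x, `|h x| <= D x) ->
  (forall x, g x <= h x) -> iint g <= iint h.
Proof.
elim: n D g h => [|n IH] D g h; first by move=> _ _ _ gh; exact: gh.
move=> [sD [I [iI DI]]] gD hD gh /=.
have bnd (f : 'rV[R]_n.+1 -> R) : (forall x, `|f x| <= D x) ->
    {ae mu, forall x, `|iint (slice f x)| <= I x}.
  move=> fD; apply: filterS2 sD DI => x sDx <-.
  by apply: norm_iint_le_mono => [f' h'|y]; [exact: IH|exact: fD].
apply: (ae_le_Rintegral_lower iI); [exact: bnd|exact: bnd|].
apply: filterS sD => x sDx.
by apply: (IH _ _ _ sDx) => y; [exact: gD|exact: hD|exact: gh].
Qed.

Lemma norm_iint_le n (D g : 'rV[R]_n -> R) : ae_iintegrable D ->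
  (forall x, `|g x| <= D x) -> `|iint g| <= iint D.
Proof. by move=> iD; apply: norm_iint_le_mono => f h; exact: iint_le. Qed.

End iterated.

(** * Lipschitz functions with bounded support *)

Section one_dim.
Variable R : realType.
Local Notation mu := (@lebesgue_measure R).
Implicit Types (f : R -> R).

Lemma lipschitz_continuous f L :
  (forall x y, `|f x - f y| <= L * `|x - y|) -> continuous f.
Proof.
move=> fL x; apply/cvgrPdist_lt => e e0.
have L0 : 0 <= L.
  by have := fL 1 0; rewrite subr0 normr1 mulr1; exact: le_trans.
near=> y; apply: (le_lt_trans (fL _ _)).
have : `|x - y| < e / (L + 1).
  by near: y; apply: cvgr_dist_lt => //; rewrite divr_gt0// ltr_wpDl.
rewrite ltr_pdivlMr ?ltr_wpDl// => xy.
by apply: le_lt_trans xy; rewrite mulrC ler_wpM2l// lerDl.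
Unshelve. all: by end_near. Qed.

Lemma indic_itvcc (a b x : R) : \1_[set` `[a, b]] x = (a <= x <= b)%R%:R :> R.
Proof. by rewrite indicE mem_setE in_itv. Qed.

Lemma lipschitz_supp_integrable f L a b B :
  (forall x y, `|f x - f y| <= L * `|x - y|) ->
  (forall x, `|f x| <= B * (a <= x <= b)%R%:R) ->
  mu.-integrable setT (EFin \o f).
Proof.
move=> fL fB.
have iB : mu.-integrable setT (fun x => B%:E * (EFin \o \1_[set` `[a, b]]) x)%E.
  by apply: integrableZl => //; exact: integrable_indic_itv.
apply: le_integrable iB => //.
  apply/measurable_EFinP; apply: continuous_measurable_fun.
  exact: lipschitz_continuous fL.
move=> x _; rewrite /= lee_fin normrM indic_itvcc normr_nat.
apply: (le_trans (fB x)); rewrite ler_wpM2r//.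
exact: ler_norm.
Qed.

Lemma Rintegral_indic_itvcc (a e : R) : 0 <= e ->
  Rintegral mu setT (fun x => (`|x - a| <= e)%R%:R) = 2 * e.
Proof.
move=> e0.
under eq_Rintegral do rewrite ler_distl -indic_itvcc.
rewrite /Rintegral integral_indic// setIT.
rewrite [X in fine X](lebesgue_measure_itv `[a - e, a + e])/= lte_fin.
have [->|ne] := eqVneq e 0; first by rewrite subr0 addr0 ltxx mulr0.
have -> : a - e < a + e by move: e0; rewrite le_eqVlt eq_sym (negbTE ne)/=; lra.
by rewrite -EFinB/=; ring.
Qed.

End one_dim.

(** * Cubes as dominating functions *)

Section boxes.
Variable R : realType.
Local Notation mu := (@lebesgue_measure R).

Lemma slice0E n (x : R) (y : 'rV[R]_n) :
  (row_mx (\row_(_ < 1) x) y : 'rV_n.+1) 0 ord0 = x.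
Proof.
by rewrite mxE; case: splitP => // j _; rewrite mxE.
Qed.

Lemma sliceSE n (x : R) (y : 'rV[R]_n) i :
  (row_mx (\row_(_ < 1) x) y : 'rV_n.+1) 0 (lift ord0 i) = y 0 i.
Proof.
rewrite mxE; case: splitP => [j|j]; first by rewrite [j]ord1.
by case=> /val_inj ->.
Qed.

(** Indicator of the closed cube with centre [a] and half-side [e], written as a product so that
    slicing splits off one factor. *)
Definition box n (a : 'rV[R]_n) (e : R) (x : 'rV[R]_n) : R :=
  \prod_(i < n) (`|x 0 i - a 0 i| <= e)%R%:R.

Lemma slice_box n (a : 'rV[R]_n.+1) e x :
  slice (box a e) x =
  fun y => (`|x - a 0 ord0| <= e)%R%:R * box (\row_i a 0 (lift ord0 i)) e y.
Proof.
apply/funext => y; rewrite /slice /box big_ord_recl slice0E; congr (_ * _).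
by apply: eq_bigr => i _; rewrite sliceSE mxE.
Qed.

Lemma iint_box n (a : 'rV[R]_n) e : 0 <= e -> iint (box a e) = (2 * e) ^+ n.
Proof.
move=> e0; elim: n a => [|n IH] a /=; first by rewrite /box big_ord0 expr0.
under eq_Rintegral do rewrite slice_box iintZ IH mulrC.
by rewrite Rintegral_lowerZ Rintegral_indic_itvcc// exprS mulrC.
Qed.

Lemma ae_iintegrable_box n (a : 'rV[R]_n) e : 0 <= e -> ae_iintegrable (box a e).
Proof.
move=> e0; elim: n a => [//|n IH] a; split.
  by apply: aeW => x; rewrite slice_box; exact: ae_iintegrableZ.
exists (fun x => (2 * e) ^+ n * \1_[set` `[a 0 ord0 - e, a 0 ord0 + e]] x); split.
  under [X in mu.-integrable _ X]eq_fun do rewrite /= EFinM.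
  by apply: integrableZl => //; exact: integrable_indic_itv.
by apply: aeW => x; rewrite slice_box iintZ iint_box// mulrC indic_itvcc ler_distl.
Qed.

Lemma boxE n (a : 'rV[R]_n) e x :
  box a e x = [forall i, `|x 0 i - a 0 i| <= e]%R%:R.
Proof.
rewrite /box; have [/forallP xi|/forallPn[i /negbTE xi]] := boolP [forall i, `|x 0 i - a 0 i| <= e].
  by rewrite big1// => i _; rewrite xi.
by rewrite (bigD1 i)//= xi mul0r.
Qed.

Lemma box_le1 n (a : 'rV[R]_n) e x : box a e x <= 1.
Proof. by rewrite boxE; case: [forall i, _]. Qed.

Lemma box_ge0 n (a : 'rV[R]_n) e x : 0 <= box a e x.
Proof. by rewrite boxE ler0n. Qed.

Lemma le_supp_box n (a : 'rV[R]_n) (e B : R) (g : 'rV[R]_n -> R) : 0 <= B ->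
  (forall (x : 'rV[R]_n) i, e < `|x 0 i - a 0 i| -> g x = 0) -> (forall x, `|g x| <= B) ->
  forall x, `|g x| <= B * box a e x.
Proof.
move=> B0 g0 gB x.
rewrite boxE; have [_|/forallPn[i]] := boolP [forall i, `|x 0 i - a 0 i| <= e]; first by rewrite mulr1.
by rewrite -ltNge => /g0 ->; rewrite normr0 mulr0.
Qed.

End boxes.

Section lipschitz.
Variable R : realType.
Local Notation mu := (@lebesgue_measure R).

(** The Lipschitz condition concerns axis directions only, which is what slices and partial
    derivatives see. [M] confines the support to a cube and [B] bounds the values. *)
Definition lip_supp n (L M B : R) (g : 'rV[R]_n -> R) :=
  [/\ forall (x : 'rV[R]_n) j h, `|g (x + h *: delta_mx 0 j) - g x| <= L * `|h|,
      forall (x : 'rV[R]_n) j, M < `|x 0 j| -> g x = 0 &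
      forall x, `|g x| <= B].

Lemma slice_shift n (x h : R) (y : 'rV[R]_n) :
  row_mx (\row_(_ < 1) (x + h)) y =
  (row_mx (\row_(_ < 1) x) y : 'rV_n.+1) + h *: delta_mx 0 ord0.
Proof.
apply/rowP => i; rewrite [RHS]mxE [X in _ = _ + X]mxE [X in _ = _ + _ * X]mxE.
case: (unliftP ord0 i) => [j ->|->]; last by rewrite !slice0E /= mulr1.
by rewrite !sliceSE /= mulr0 addr0.
Qed.

Lemma slice_shiftS n (x h : R) (y : 'rV[R]_n) j :
  row_mx (\row_(_ < 1) x) (y + h *: delta_mx 0 j) =
  (row_mx (\row_(_ < 1) x) y : 'rV_n.+1) + h *: delta_mx 0 (lift ord0 j).
Proof.
apply/rowP => i; rewrite [RHS]mxE [X in _ = _ + X]mxE [X in _ = _ + _ * X]mxE.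
case: (unliftP ord0 i) => [k ->|->]; last by rewrite !slice0E /= mulr0 addr0.
by rewrite !sliceSE !mxE eqxx/= (inj_eq (@lift_inj _ _)).
Qed.

Lemma lip_supp_slice n L M B (g : 'rV[R]_n.+1 -> R) x :
  lip_supp L M B g -> lip_supp L M B (slice g x).
Proof.
move=> [gL gM gB]; split=> [y j h|y j yM|y]; rewrite /slice.
- by rewrite slice_shiftS.
- by apply: (gM _ (lift ord0 j)); rewrite sliceSE.
- exact: gB.
Qed.

Lemma lip_supp_box n L M B (g : 'rV[R]_n -> R) : lip_supp L M B g ->
  forall x, `|g x| <= B * box 0 M x.
Proof.
move=> [_ gM gB]; apply: le_supp_box => //; first exact: le_trans (normr_ge0 _) (gB 0).
by move=> x i; rewrite mxE subr0; exact: gM.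
Qed.

(** By induction, the integral of the slice at [x] is Lipschitz in [x] with constant [L (2M)^n] and
    vanishes outside [[-M, M]], hence is integrable on the line. *)
Lemma lip_supp_ae_iintegrable n L M B (g : 'rV[R]_n -> R) : 0 <= M ->
  lip_supp L M B g -> ae_iintegrable g.
Proof.
move=> M0; elim: n g => [//|n IH] g gLMB; have [gL gM gB] := gLMB.
have sg x : ae_iintegrable (slice g x) by apply: IH; exact: lip_supp_slice.
split; first exact: aeW.
exists (fun x => iint (slice g x)); split; last exact: aeW.
have ibox c : ae_iintegrable (fun y : 'rV[R]_n => c * box 0 M y).
  by apply: ae_iintegrableZ; exact: ae_iintegrable_box.
apply: (@lipschitz_supp_integrable _ _ (L * (2 * M) ^+ n) (- M) M (B * (2 * M) ^+ n)).
  move=> x y.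
  have -> : iint (slice g x) - iint (slice g y) =
      iint (fun z => slice g x z + -1 * slice g y z).
    have [_ ->] := ae_iintegrableD (sg x) (ae_iintegrableZ (-1) (sg y)).
    by rewrite iintZ mulN1r.
  have -> : L * (2 * M) ^+ n * `|x - y| = iint (fun z : 'rV[R]_n => L * `|x - y| * box 0 M z).
    by rewrite iintZ iint_box//; ring.
  apply: (norm_iint_le (ibox (L * `|x - y|))); apply: le_supp_box => [|z i|z].
  - exact: le_trans (normr_ge0 _) (gL 0 ord0 (x - y)).
  - rewrite mxE subr0 => zM.
    have s0 t : slice g t z = 0 by apply: (gM _ (lift ord0 i)); rewrite sliceSE.
    by rewrite !s0 mulr0 addr0.
  - have := gL (row_mx (\row_(_ < 1) y) z) ord0 (x - y).
    by rewrite -slice_shift [y + _]addrC subrK mulN1r.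
move=> x.
have [xM|xM] := boolP (- M <= x <= M).
  rewrite mulr1 -(iint_box (0 : 'rV[R]_n) M0) -iintZ; apply: (norm_iint_le (ibox B)).
  exact/lip_supp_box/lip_supp_slice/gLMB.
rewrite (_ : slice g x = fun=> 0) ?iint0 ?normr0 ?mulr0//.
apply/funext => y; apply: (gM _ ord0); rewrite slice0E.
by rewrite ltNge ler_norml.
Qed.

Lemma lip_suppD n L1 L2 M B1 B2 (g h : 'rV[R]_n -> R) :
  lip_supp L1 M B1 g -> lip_supp L2 M B2 h ->
  lip_supp (L1 + L2) M (B1 + B2) (fun x => g x + h x).
Proof.
move=> [gL gM gB] [hL hM hB]; split=> [x j t|x j xM|x].
- by rewrite opprD addrACA mulrDl (le_trans (ler_normD _ _))// lerD.
- by rewrite (gM x j)// (hM x j)// addr0.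
- by rewrite (le_trans (ler_normD _ _))// lerD.
Qed.

Lemma lip_suppM n L1 L2 M B1 B2 (g h : 'rV[R]_n -> R) :
  lip_supp L1 M B1 g -> lip_supp L2 M B2 h ->
  lip_supp (L1 * B2 + B1 * L2) M (B1 * B2) (fun x => g x * h x).
Proof.
move=> [gL gM gB] [hL hM hB]; split=> [x j t|x j xM|x].
- set y := x + _.
  have -> : g y * h y - g x * h x = (g y - g x) * h y + g x * (h y - h x) by ring.
  rewrite (le_trans (ler_normD _ _))// !normrM mulrDl lerD//.
    by rewrite mulrAC; apply: ler_pM => //; exact: gL.
  by rewrite -mulrA; apply: ler_pM => //; exact: hL.
- by rewrite (gM x j)// mul0r.
- by rewrite normrM ler_pM.
Qed.

Lemma lip_supp0 n M : lip_supp 0 M 0 (fun _ : 'rV[R]_n => 0).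
Proof. by split=> // *; rewrite ?subrr ?mul0r normr0. Qed.

End lipschitz.

(** * Derivatives on the line *)

Section one_dim_fundamental.
Variable R : realType.
Local Notation mu := (@lebesgue_measure R).
Implicit Types (f F : R -> R).

Lemma continuous_addr (h : R) : continuous (fun x : R => x + h).
Proof. by move=> x; apply: cvgD; [exact: cvg_id|exact: cvg_cst]. Qed.

Lemma ge0_integral_shift f h : continuous f -> (forall x, 0 <= f x) ->
  (\int[mu]_x (f (x + h))%:E = \int[mu]_x (f x)%:E)%E.
Proof.
move=> cf f0.
have D1 : (fun x : R => x + h)^`()%classic = cst 1.
  apply/funext => x; rewrite derive1E.
  exact: (@derive_val _ _ _ _ _ _ _ (is_derive_shift x 1 h)).
rewrite [RHS](@increasing_ge0_integration_by_substitutionT _ (fun x => x + h))//.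
- by apply: eq_integral => x _; rewrite D1 /= mulr1.
- by move=> x y; rewrite ltrD2r.
- by rewrite D1; exact: cst_continuous.
- by rewrite D1; exact: is_cvg_cst.
- by rewrite D1; exact: is_cvg_cst.
- exact: cvg_addrr_Ny.
- exact: cvg_addrr.
Qed.

(** The substitution rule is available for nonnegative integrands, so it is applied to [|f|] and to
    [f + |f|], and the difference is taken. *)
Lemma Rintegral_shift f h : continuous f ->
  mu.-integrable setT (EFin \o f) ->
  mu.-integrable setT (EFin \o (fun x => f (x + h))) ->
  Rintegral mu setT (fun x => f (x + h)) = Rintegral mu setT f.
Proof.
move=> cf fi fhi.
have sh (g : R -> R) : continuous g -> (forall x, 0 <= g x) ->
    Rintegral mu setT (fun x => g (x + h)) = Rintegral mu setT g.
  by move=> cg g0; rewrite /Rintegral ge0_integral_shift.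
have cn : continuous (fun x => `|f x|).
  by move=> x; apply: cvg_norm; exact: cf.
have ni (g : R -> R) : mu.-integrable setT (EFin \o g) ->
    mu.-integrable setT (EFin \o (fun x => `|g x|)).
  by move=> gi; exact: (integrable_abse gi).
have E (g : R -> R) : mu.-integrable setT (EFin \o g) ->
    Rintegral mu setT (fun x => g x + `|g x|) =
    Rintegral mu setT g + Rintegral mu setT (fun x => `|g x|).
  by move=> gi; apply: RintegralD => //; exact: ni.
apply: (addIr (Rintegral mu setT (fun x => `|f x|))).
rewrite -[in RHS]E// -[in LHS](sh (fun x => `|f x|))// -E//.
rewrite (sh (fun x => f x + `|f x|))//.
  by move=> x; apply: cvgD; [exact: cf|exact: cn].
by move=> x; rewrite addrC -lerBlDr sub0r ler_normr lexx orbT.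
Qed.

Lemma measurable_seq (E : seq R) : measurable ([set` E] : set R).
Proof.
elim: E => [|x E IH].
  by rewrite (_ : [set` [::]] = set0) // -subset0 => y.
rewrite (_ : [set` x :: E] = [set x] `|` [set` E]); first exact: measurableU.
by apply/predeqP => y /=; rewrite inE; split=> [/predU1P|[->|->]]; rewrite ?eqxx ?orbT.
Qed.

Lemma ae_notin_seq (E : seq R) : {ae mu, forall x, x \notin E}.
Proof.
exists [set` E]; split; [exact: measurable_seq| |].
  by apply: countable_lebesgue_measure0; apply: finite_set_countable; exact: finite_seq.
by move=> x /= /negP; rewrite negbK.
Qed.

Lemma derivable_cvg_harmonic F x : derivable F x 1 ->
  (fun n => (@harmonic R n)^-1 * (F (x + harmonic n) - F x)) @ \oo --> 'D_1 F x.
Proof.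
move=> /cvg_ex[l Fl].
have -> : 'D_1 F x = l by exact: cvg_lim.
rewrite (_ : (fun n => _) =
  (fun h => h^-1 *: (F (h *: 1 + x) - F x)) \o (@harmonic R)); last first.
  by apply/funext => n /=; rewrite [h in F (h + x)]mulr1 [x + _]addrC.
apply: cvg_comp Fl => P; rewrite /dnbhs /within /= => P0.
apply: (@filterS _ \oo _ _ _ _ (cvg_harmonic P0)) => n /=; apply.
by rewrite gt_eqF// invr_gt0 ltr0n.
Qed.

(** By translation invariance each difference quotient of [F] has integral 0. The quotients are
    bounded by [L] on a fixed interval, so dominated convergence passes this to the derivative. *)
Lemma integral_derive_eq0 F (L a b B : R) (E : seq R) :
  (forall x y, `|F x - F y| <= L * `|x - y|) ->
  (forall x, `|F x| <= B * (a <= x <= b)%R%:R) ->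
  (forall x, x \notin E -> derivable F x 1) ->
  let F' x := if x \in E then 0 else 'D_1 F x in
  mu.-integrable setT (EFin \o F') /\ Rintegral mu setT F' = 0.
Proof.
move=> FL FB FE F'.
have L0 : 0 <= L.
  by have := FL 1 0; rewrite subr0 normr1 mulr1; exact: le_trans.
pose D n x := (@harmonic R n)^-1 * (F (x + harmonic n) - F x).
(* Zeroing the quotients on [E] makes them converge to [F'] at every point, which yields the
   measurability of [F']. *)
pose DE n x := if x \in E then 0 else D n x.
have iF : mu.-integrable setT (EFin \o F) by exact: lipschitz_supp_integrable FL FB.
have iFh h : mu.-integrable setT (EFin \o (fun x => F (x + h))).
  apply: (@lipschitz_supp_integrable _ _ L (a - h) (b - h) B) => [x y|x].
    by apply: le_trans (FL _ _) _; rewrite opprD addrACA subrr addr0.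
  by rewrite lerBlDr lerBrDr.
have cF : continuous F by exact: lipschitz_continuous FL.
have D0 n : Rintegral mu setT (D n) = 0.
  rewrite Rintegral_lowerZ RintegralB// Rintegral_shift// subrr mulr0//.
have mD n : measurable_fun setT (D n).
  apply: continuous_measurable_fun => x; apply: cvgM; first exact: cvg_cst.
  apply: cvgB; last exact: cF.
  by apply: continuous_comp; [exact: continuous_addr|exact: cF].
have mDE n : measurable_fun setT (DE n).
  rewrite (_ : DE n = fun x => \1_(~` [set` E]) x * D n x).
    by apply: measurable_funM => //; apply: measurable_indic; exact: measurableC (measurable_seq E).
  apply/funext => x; rewrite /DE indicE in_setC mem_setE.
  by case: ifP; rewrite ?mul0r ?mul1r.
have DE_F' x : DE ^~ x @ \oo --> F' x.
  rewrite /DE /F'; case: ifPn => xE; first exact: cvg_cst.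
  by apply: derivable_cvg_harmonic; exact: FE.
have mF' : measurable_fun setT F' by apply: measurable_fun_cvg mDE _ => x _.
(* The steps [harmonic n] are at most 1, so [x + harmonic n] can reach the support only from
   [x >= a - 1]. *)
have DEB n x : `|DE n x| <= L * (a - 1 <= x <= b)%R%:R.
  rewrite /DE; case: ifP => _; first by rewrite normr0 mulr_ge0.
  have h0 := @harmonic_gt0 R n.
  rewrite /D normrM gtr0_norm ?invr_gt0// ler_pdivrMl//.
  have [_|xab] := boolP (a - 1 <= x <= b).
    by rewrite mulr1 mulrC; apply: le_trans (FL _ _) _; rewrite addrAC subrr add0r gtr0_norm.
  have F0 y : ~~ (a <= y <= b) -> F y = 0.
    by move=> yab; apply/eqP; rewrite -normr_le0 (le_trans (FB y))// (negbTE yab) mulr0.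
  have h1 : harmonic n <= 1 :> R by rewrite invf_le1// ler1n.
  rewrite !F0 ?subrr ?normr0 ?mulr0//.
    apply: contraNN xab => /andP[]; lra.
  apply: contraNN xab => /andP[]; lra.
have iB : mu.-integrable setT
    (fun x => L%:E * (EFin \o \1_[set` `[(a - 1)%R, b]]) x)%E.
  by apply: integrableZl => //; exact: integrable_indic_itv.
have [| | | |iF' _ lim] := @dominated_convergence _ _ _ mu setT measurableT
  (fun n x => (DE n x)%:E) (EFin \o F') _ _ _ _ iB.
- by move=> n; apply/measurable_EFinP; exact: mDE.
- exact/measurable_EFinP.
- by apply: aeW => x _; apply: cvg_EFin (DE_F' x); exact: nearW.
- apply: aeW => x n _; rewrite /= lee_fin indic_itvcc; exact: DEB.
split => //.
rewrite /Rintegral (_ : (\int[mu]_x (F' x)%:E)%E = 0%E)//.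
move: lim; rewrite (_ : [sequence _]_n = cst 0%E); last first.
  apply/funext => n /=.
  rewrite (@ae_eq_integral_lower _ _ _ mu _ (EFin \o D n)); last first.
    apply: filterS (ae_notin_seq E) => x xE.
    by rewrite /= /DE (negbTE xE).
  rewrite -[LHS]fineK; first by rewrite -[fine _]/(Rintegral mu setT (D n)) D0.
  apply: integrable_fin_num => //.
  apply: (@integrableZl _ _ _ mu setT measurableT _ (EFin \o (fun x => F (x + harmonic n) - F x))).
  exact: (integrableB measurableT (iFh _) iF).
by move=> /(cvg_lim (@ereal_hausdorff R)) <-; rewrite lim_cst.
Qed.

End one_dim_fundamental.

(** * A weighted inequality on one line *)

Section poincare_line.
Variable R : realType.
Local Notation mu := (@lebesgue_measure R).

(** The function [F x = (x - a) * Phi x] is Lipschitz with bounded support, so its derivative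
    integrates to 0. Subtracting [F'] from [Phi / 2] leaves exactly the expression that the last
    hypothesis bounds by [G]. In the application [Phi] is the squared length of a field and [G] a
    multiple of its squared gradient. *)
Lemma poincare_line (Phi G : R -> R) (L a M B : R) (E : seq R) : 0 <= M ->
  (forall x y, `|Phi x - Phi y| <= L * `|x - y|) ->
  (forall x, `|Phi x| <= B * (a - M <= x <= a + M)%R%:R) ->
  (forall x, `|G x| <= B * (a - M <= x <= a + M)%R%:R) ->
  (forall x, x \notin E -> derivable Phi x 1) ->
  (forall x, x \notin E -> - ((x - a) * 'D_1 Phi x) - 2^-1 * Phi x <= G x) ->
  2^-1 * Rintegral mu setT Phi <= Rintegral mu setT G.
Proof.
move=> M0 PL PB GB PE PG.
have L0 : 0 <= L.
  by have := PL 1 0; rewrite subr0 normr1 mulr1; exact: le_trans.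
have P0 x : ~~ (a - M <= x <= a + M) -> Phi x = 0.
  by move=> xab; apply/eqP; rewrite -normr_le0 (le_trans (PB x))// (negbTE xab) mulr0.
have B0 : 0 <= B.
  have := PB a; rewrite (_ : _ && _) ?mulr1; first exact: le_trans.
  by apply/andP; split; lra.
have PB' x : `|Phi x| <= B.
  by apply: (le_trans (PB x)); case: (_ && _); rewrite ?mulr1 ?mulr0.
pose F x := (x - a) * Phi x.
have FL x y : `|F x - F y| <= (M * L + B) * `|x - y|.
  (* If neither point lies in the support interval, both values vanish; otherwise symmetry lets [x]
     be in it, where [|x - a| <= M]. *)
  wlog xM : x y / a - M <= x <= a + M => [wl|].
    have [xM|xM] := boolP (a - M <= x <= a + M); first exact: wl.
    have [yM|yM] := boolP (a - M <= y <= a + M).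
      by rewrite distrC [`|x - y|]distrC; exact: wl.
    by rewrite /F !P0// !mulr0 subrr normr0 mulr_ge0// addr_ge0// mulr_ge0.
  have -> : F x - F y = (x - a) * (Phi x - Phi y) + (x - y) * Phi y.
    by rewrite /F; ring.
  rewrite (le_trans (ler_normD _ _))// !normrM mulrDl lerD//.
    by rewrite -mulrA ler_pM// ler_norml; apply/andP; split; lra.
  by rewrite mulrC ler_wpM2r.
have FB x : `|F x| <= (M * B) * (a - M <= x <= a + M)%R%:R.
  have [xM|xM] := boolP (a - M <= x <= a + M).
    by rewrite mulr1 normrM ler_pM// ler_norml; apply/andP; split; lra.
  by rewrite /F P0// mulr0 normr0 mulr0.
have dF x : x \notin E -> is_derive x 1 F (Phi x + (x - a) * 'D_1 Phi x).
  move=> xE; have dP := derivableP (PE x xE).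
  have dx : is_derive x 1 (fun y : R => y - a) 1.
    by apply: is_derive_eq; rewrite subr0.
  apply: (@is_derive_eq _ _ _ (((fun y : R => y - a) * Phi) : R -> R)).
  by rewrite addrC /GRing.scale/= mulr1.
have dF' x : x \notin E -> derivable F x 1 by move=> /dF [].
have [] := integral_derive_eq0 FL FB dF'.
set F' := (fun x => if _ then _ else _) => iF' intF'.
have iP : mu.-integrable setT (EFin \o Phi) by exact: lipschitz_supp_integrable PL PB.
have iP2 : mu.-integrable setT (EFin \o (fun x => 2^-1 * Phi x)).
  exact: (integrableZl measurableT _ iP).
pose W x := 2^-1 * Phi x - F' x.
have iW : mu.-integrable setT (EFin \o W) by exact: (integrableB measurableT iP2 iF').
have -> : 2^-1 * Rintegral mu setT Phi = Rintegral mu setT W.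
  by rewrite RintegralB// intF' subr0 Rintegral_lowerZ.
have iD : mu.-integrable setT
    (EFin \o (fun x => `|W x| + B * \1_[set` `[a - M, a + M]] x)).
  have iI := integrableZl measurableT B (@integrable_indic_itv R (a - M) (a + M) true false).
  exact: (integrableD measurableT (integrable_abse iW) iI).
apply: (ae_le_Rintegral_lower iD).
- by apply: aeW => x; rewrite lerDl indic_itvcc mulr_ge0.
- apply: aeW => x; rewrite indic_itvcc; apply: (le_trans (GB x)).
  by rewrite lerDr.
- apply: filterS (ae_notin_seq E) => x xE; apply: le_trans (PG x xE).
  by rewrite /W /F' (negbTE xE); case: (dF x xE) => _ ->; lra.
Qed.

End poincare_line.

Section iint_last.
Variable R : realType.
Local Notation mu := (@lebesgue_measure R).

(* The last coordinate is the innermost variable of the iterated integral. *)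
Lemma iint_last_le n (C : R) (D g h : 'rV[R]_n.+1 -> R) : 0 <= C ->
  ae_iintegrable D -> (forall x, `|g x| <= D x) -> (forall x, `|h x| <= D x) ->
  (forall x, Rintegral mu setT (fun s => g (x + s *: delta_mx 0 ord_max)) <=
     C * Rintegral mu setT (fun s => h (x + s *: delta_mx 0 ord_max))) ->
  iint g <= C * iint h.
Proof.
move=> C0; elim: n D g h => [|n IH] D g h iD gD hD gh.
  have E (f : 'rV[R]_1 -> R) :
      iint f = Rintegral mu setT (fun s => f (0 + s *: delta_mx 0 ord_max)).
    rewrite /=; apply: eq_Rintegral => x _; rewrite /slice; congr f.
    apply/rowP => i; case: (unliftP ord0 i) => [[]//|->].
    by rewrite slice0E add0r 2!mxE /= mulr1.
  by rewrite !E.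
case: iD => sD [I [iI DI]].
(* The factor [1 + C] lets one function dominate both the integral of the slice of [g] and [C] times
   that of [h]. *)
have I1 : mu.-integrable setT (EFin \o (fun x => (1 + C) * I x)).
  exact: (integrableZl measurableT _ iI).
rewrite [iint g]/= [iint h]/= -Rintegral_lowerZ; apply: (ae_le_Rintegral_lower I1).
- apply: filterS2 sD DI => x sDx DIx.
  have gI : `|iint (slice g x)| <= I x.
    by rewrite -DIx; apply: norm_iint_le => // y; exact: gD.
  apply: (le_trans gI); rewrite mulrDl mul1r lerDl mulr_ge0//.
  exact: le_trans (normr_ge0 _) gI.
- apply: filterS2 sD DI => x sDx DIx.
  have hI : `|iint (slice h x)| <= I x.
    by rewrite -DIx; apply: norm_iint_le => // y; exact: hD.
  rewrite normrM (ger0_norm C0) mulrDl mul1r.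
  apply: ler_wpDl; first exact: le_trans (normr_ge0 _) hI.
  by rewrite ler_wpM2l.
- apply: filterS sD => x sDx; apply: (IH _ _ _ sDx) => y; [exact: gD|exact: hD|].
  have E (f : 'rV[R]_n.+2 -> R) s : slice f x (y + s *: delta_mx 0 ord_max) =
      f (row_mx (\row_(_ < 1) x) y + s *: delta_mx 0 ord_max).
    rewrite /slice slice_shiftS; congr (f (_ + _ *: delta_mx _ _)).
    exact: val_inj.
  rewrite [X in X <= _](_ : _ = Rintegral mu setT
    (fun s => g (row_mx (\row_(_ < 1) x) y + s *: delta_mx 0 ord_max))).
    rewrite [X in _ <= C * X](_ : _ = Rintegral mu setT
      (fun s => h (row_mx (\row_(_ < 1) x) y + s *: delta_mx 0 ord_max))).
      exact: gh.
    by apply: eq_Rintegral => s _; rewrite E.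
  by apply: eq_Rintegral => s _; rewrite E.
Qed.

End iint_last.

(** * Piecewise polynomials *)

Section piecewise.
Variable R : realType.

Lemma hull_convex d (P : seq 'rV[R]_d) x y t : hull P x -> hull P y ->
  0 <= t <= 1 -> hull P (t *: x + (1 - t) *: y).
Proof.
move=> [lx [lx0 [lx1 ->]]] [ly [ly0 [ly1 ->]]] /andP[t0 t1].
exists (fun i => t * lx i + (1 - t) * ly i); split; [|split].
- by move=> i; rewrite addr_ge0// mulr_ge0// subr_ge0.
- by rewrite big_split/= -!mulr_sumr lx1 ly1; ring.
- rewrite !scaler_sumr -big_split/=; apply: eq_bigr => i _.
  by rewrite !scalerA -scalerDl.
Qed.

(** A consequence of convexity; each simplex then contributes at most two exceptional parameters to
    a line. *)
Lemma hull_line_interval d (P : seq 'rV[R]_d) x v :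
  is_interval [set s : R | hull P (x + s *: v)].
Proof.
move=> a b /= Pa Pb c /andP[ac cb].
have [ab|ab] := eqVneq a b; first by rewrite (_ : c = a)//; apply/le_anti; rewrite ac ab cb.
have ab' : 0 < b - a by rewrite subr_gt0 lt_neqAle ab (le_trans ac cb).
pose t := (b - c) / (b - a).
have t01 : 0 <= t <= 1.
  by rewrite divr_ge0 ?subr_ge0// ?(le_trans ac cb)//= ler_pdivrMr// mul1r; lra.
have := hull_convex Pa Pb t01; rewrite !scalerDr !scalerA.
rewrite addrACA -!scalerDl addrCA subrr addr0 scale1r.
congr (hull P (_ + _ *: _)).
rewrite /t; field; exact: lt0r_neq0.
Qed.

(** [E] collects the finite endpoints of [J]. Away from them, each of the two bound conditions is
    locally constant. *)
Lemma interval_eventually (J : set R) : is_interval J ->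
  exists E : seq R, forall s, s \notin E ->
    (\forall t \near s, J t) \/ (\forall t \near s, ~ J t).
Proof.
move=> /is_intervalP ->; case: (Rhull J) => bl br.
pose ends (b : itv_bound R) := if b is BSide _ x then [:: x] else [::].
exists (ends bl ++ ends br) => s; rewrite mem_cat negb_or => /andP[sl sr].
have L : (\forall t \near s, (bl <= BLeft t)%O) \/ (\forall t \near s, ~ (bl <= BLeft t)%O).
  case: bl sl => [b x|[]]/=; last 2 first.
  - by move=> _; left; near=> t; rewrite bnd_simp.
  - by move=> _; right; near=> t; rewrite bnd_simp.
  rewrite inE => sx; case: (ltgtP s x) sx => // sx _; [right|left].
    near=> t; have tx : t < x by near: t; exact: lt_nbhsl.
    by apply/negP; case: b; rewrite bnd_simp -?ltNge -?leNgt ?ltW.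
  near=> t; have xt : x < t by near: t; exact: lt_nbhsr.
  by case: b; rewrite bnd_simp// ltW.
have U : (\forall t \near s, (BRight t <= br)%O) \/ (\forall t \near s, ~ (BRight t <= br)%O).
  case: br sr => [b x|[]]/=; last 2 first.
  - by move=> _; right; near=> t; rewrite bnd_simp.
  - by move=> _; left; near=> t; rewrite bnd_simp.
  rewrite inE => sx; case: (ltgtP s x) sx => // sx _; [left|right].
    near=> t; have tx : t < x by near: t; exact: lt_nbhsl.
    by case: b; rewrite bnd_simp// ltW.
  near=> t; have xt : x < t by near: t; exact: lt_nbhsr.
  by apply/negP; case: b; rewrite bnd_simp -?ltNge -?leNgt ?ltW.
case: L => L; last first.
  by right; apply: filterS L => t + /= /andP[].
case: U => U; last first.
  by right; apply: filterS U => t + /= /andP[].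
by left; apply: filterS2 L U => t l u /=; apply/andP.
Unshelve. all: by end_near. Qed.

Lemma finite_exceptions_lipschitz (f : R -> R) (L : R) (E : seq R) :
  continuous f ->
  (forall s, s \notin E -> derivable f s 1 /\ `|'D_1 f s| <= L) ->
  forall x y, `|f x - f y| <= L * `|x - y|.
Proof.
move=> cf fE.
(* Restricting the hypothesis to the open interval allows induction on [E]: split at an exceptional
   point lying inside, and use the mean value theorem once none is left. *)
suff H a b : a < b -> (forall s, s \in `]a, b[ -> s \notin E ->
    derivable f s 1 /\ `|'D_1 f s| <= L) -> `|f b - f a| <= L * (b - a).
  move=> x y; wlog xy : x y / y <= x => [wl|].
    have [/wl//|/ltW/wl] := leP y x.
    by rewrite distrC [`|y - x|]distrC.
  move: xy; rewrite le_eqVlt => /predU1P[->|xy].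
    by rewrite !subrr normr0 mulr0.
  by rewrite [`|x - y|]gtr0_norm ?subr_gt0//; apply: H => // s _; exact: fE.
elim: (E) a b {fE} => [|c E' IH] a b ab fE.
  have [| |c cab ->] := @MVT R f (fun s => 'D_1 f s) a b ab.
  - by move=> s sab; apply/derivableP; exact: (fE s sab _).1.
  - exact: continuous_subspaceT.
  - rewrite normrM [`|b - a|]gtr0_norm ?subr_gt0// ler_wpM2r ?subr_ge0 ?(ltW ab)//.
    exact: (fE c cab _).2.
have [cab|cab] := boolP (c \in `]a, b[).
  move: (cab); rewrite in_itv/= => /andP[ac cb].
  have h1 : `|f c - f a| <= L * (c - a).
    apply: IH => // s; rewrite in_itv/= => /andP[as_ sc] sE; apply: fE.
      by rewrite in_itv/= as_ (lt_trans sc).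
    by rewrite inE negb_or lt_eqF.
  have h2 : `|f b - f c| <= L * (b - c).
    apply: IH => // s; rewrite in_itv/= => /andP[cs sb] sE; apply: fE.
      by rewrite in_itv/= sb andbT (lt_trans ac).
    by rewrite inE negb_or gt_eqF.
  have -> : f b - f a = (f b - f c) + (f c - f a) by ring.
  by apply: (le_trans (ler_normD _ _)); apply: le_trans (lerD h2 h1) _; lra.
apply: IH => // s sab sE; apply: fE => //.
by rewrite inE negb_or sE andbT; apply: contraNneq cab => <-.
Qed.

Lemma poly_le_line d r (p : 'rV[R]_d -> R) x j : poly_le r p ->
  exists P : {poly R}, forall s, p (x + s *: delta_mx 0 j) = P.[s].
Proof.
move=> [l [_ pE]].
exists (\sum_(mc <- l) mc.2%:P *
  \prod_(i < d) ((x 0 i)%:P + (i == j)%:R *: 'X) ^+ (mc.1 : {ffun 'I_d -> nat}) i).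
move=> s; rewrite pE horner_sum; apply: eq_bigr => mc _.
rewrite hornerM hornerC; congr (_ * _); rewrite horner_prod.
apply: eq_bigr => i _; rewrite horner_exp hornerD hornerC hornerZ hornerX.
by rewrite !mxE eqxx/= mulrC.
Qed.

Definition in_box d (M : R) (x : 'rV[R]_d) := forall i, `|x 0 i| <= M.

(** Polynomials are bounded and Lipschitz only on bounded sets, hence the cube. The two constants
    form a pair so that one use of [choice] selects them for all simplices. *)
Definition lip_box d (M : R) (f : 'rV[R]_d -> R) := exists LB : R * R,
  [/\ 0 <= LB.1, 0 <= LB.2, forall x, in_box M x -> `|f x| <= LB.2 &
   forall x j h, in_box M x -> in_box M (x + h *: delta_mx 0 j) ->
     `|f (x + h *: delta_mx 0 j) - f x| <= LB.1 * `|h|].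

Lemma lip_boxD d M (f g : 'rV[R]_d -> R) : lip_box M f -> lip_box M g ->
  lip_box M (fun x => f x + g x).
Proof.
move=> [[L1 B1] [/= L10 B10 fB fL]] [[L2 B2] [/= L20 B20 gB gL]].
exists (L1 + L2, B1 + B2); split => /=; rewrite ?addr_ge0//.
- by move=> x Mx; rewrite (le_trans (ler_normD _ _))// lerD ?fB ?gB.
- move=> x j h Mx Mxh; rewrite opprD addrACA mulrDl.
  by rewrite (le_trans (ler_normD _ _))// lerD ?fL ?gL.
Qed.

Lemma lip_boxM d M (f g : 'rV[R]_d -> R) : lip_box M f -> lip_box M g ->
  lip_box M (fun x => f x * g x).
Proof.
move=> [[L1 B1] [/= L10 B10 fB fL]] [[L2 B2] [/= L20 B20 gB gL]].
exists (L1 * B2 + B1 * L2, B1 * B2); split => /=; rewrite ?addr_ge0 ?mulr_ge0//.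
- by move=> x Mx; rewrite normrM ler_pM ?fB ?gB.
- move=> x j h Mx Mxh; set y := x + _.
  have -> : f y * g y - f x * g x = (f y - f x) * g y + f x * (g y - g x) by ring.
  rewrite (le_trans (ler_normD _ _))// !normrM mulrDl lerD//.
    by rewrite mulrAC; apply: ler_pM; rewrite ?gB//; exact: fL.
  by rewrite -mulrA; apply: ler_pM; rewrite ?fB//; exact: gL.
Qed.

Lemma lip_box_cst d M (c : R) : lip_box M (fun _ : 'rV[R]_d => c).
Proof.
by exists (0, `|c|); split => //= x j h _ _; rewrite subrr normr0 mul0r.
Qed.

Lemma lip_box_coord d M i : 0 <= M -> lip_box M (fun x : 'rV[R]_d => x 0 i).
Proof.
move=> M0; exists (1, M); split => //= x j h _ _.
rewrite !mxE addrAC subrr add0r normrM mul1r ler_piMr//.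
by case: (_ && _); rewrite ?normr1 ?normr0.
Qed.

Lemma poly_le_lip_box d r M (p : 'rV[R]_d -> R) : 0 <= M -> poly_le r p ->
  lip_box M p.
Proof.
move=> M0 [l [_ /funext ->]].
have lX (i : 'I_d) n : lip_box M (fun x : 'rV[R]_d => x 0 i ^+ n).
  elim: n => [|n IH]; first by under eq_fun do rewrite expr0; exact: lip_box_cst.
  by under eq_fun do rewrite exprS; apply: lip_boxM IH; exact: lip_box_coord.
elim: l => [|mc l IH].
  by under eq_fun do rewrite big_nil; exact: lip_box_cst.
under eq_fun do rewrite big_cons.
apply: lip_boxD IH; apply: lip_boxM; first exact: lip_box_cst.
elim: (index_enum _) => [|i s IH].
  by under eq_fun do rewrite big_nil; exact: lip_box_cst.
under eq_fun do rewrite big_cons.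
by apply: lip_boxM IH; exact: lX.
Qed.

End piecewise.

(** * Regularity of finite element fields along lines *)

Section finite_elements.
Variable R : realType.
Local Notation mu := (@lebesgue_measure R).

Lemma bounded_closure_in_box d (Om : set 'rV[R]_d) : bounded_set Om ->
  exists M, 0 < M /\ forall x, closure Om x -> in_box M x.
Proof.
(* A point of the closure lies within distance 1 of a point of [Om], hence [M + 1]. *)
move=> /pinfty_ex_gt0[M M0 OmM]; exists (M + 1); split; first exact: addr_gt0.
move=> x /(_ (ball x 1))[|y [Omy xy] i]; first exact: nbhsx_ballx.
have yM : `|y 0 i| <= M.
  have /= := OmM y Omy; apply: le_trans.
  rewrite -[leRHS]/(mx_norm y) mx_normrE.
  exact: (le_bigmax _ (fun ij => `|y ij.1 ij.2|) (0, i)).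
have /ltW xyi : `|x 0 i - y 0 i| < 1 by have [_ /(_ 0 i)] := xy.
rewrite -(subrK (y 0 i) (x 0 i)) addrC.
by apply: (le_trans (ler_normD _ _)); exact: lerD.
Qed.

Lemma pd_line d (g : 'rV[R]_d -> R) j (x : 'rV[R]_d) (s : R) :
  pd g j (x + s *: delta_mx 0 j) = 'D_1 (fun t : R => g (x + t *: delta_mx 0 j)) s.
Proof.
rewrite /pd /derive; apply: (congr1 (fun f : R -> R => lim (f h @[h --> 0^']))).
apply/funext => h /=.
congr (h^-1 *: (g _ - _)).
rewrite [X in _ = _ + (X + _) *: _](_ : _ = h); last exact: mulr1.
by rewrite scalerDl addrCA.
Qed.

(* [point] is the junk value of [lim] where [g] is not differentiable. *)
Lemma pd_bound d (g : 'rV[R]_d -> R) j L :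
  (forall (x : 'rV[R]_d) (h : R), `|g (x + h *: delta_mx 0 j) - g x| <= L * `|h|) ->
  forall x, `|pd g j x| <= Num.max L `|point : R|.
Proof.
move=> gL x; rewrite /pd /derive.
set F := (X in lim X).
have [cF|/dvgP ->] := pselect (cvg F); last by rewrite le_max lexx orbT.
rewrite le_max; apply/orP; left.
rewrite -(cvg_lim _ (cvg_norm cF))//.
apply: limr_le; first exact: is_cvg_norm.
rewrite /dnbhs; near=> h.
rewrite normrZ normfV ler_pdivrMl ?normr_gt0; last by near: h; exact: nbhs_dnbhs_neq.
rewrite [leRHS]mulrC /= [_ *: _ + x]addrC; exact: gL.
Unshelve. all: by end_near. Qed.

Section mesh.
Variables (d m : nat) (Om : set 'rV[R]_d) (K : 'I_m -> 'I_d.+1 -> 'rV[R]_d).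
Hypothesis coverK : [set x | exists e, simplex (K e) x] = closure Om.
Local Notation line x j := (fun s : R => x + s *: delta_mx 0 j).

(** Near such a parameter, a field of [Wh] restricted to the line agrees with a single polynomial,
    namely 0 in the second case. *)
Definition regular_point (x : 'rV[R]_d) j (s : R) :=
  (exists e, \forall t \near s, simplex (K e) (line x j t)) \/
  (\forall t \near s, ~ Om (line x j t)).

(** The exceptions are the endpoints of the intervals cut out by the simplices. Elsewhere, if no
    simplex contains a neighbourhood, all of them miss one, and so does [Om], which they cover. *)
Lemma regular_point_exceptions x j : exists E : seq R,
  forall s, s \notin E -> regular_point x j s.
Proof.
have H e := interval_eventually (@hull_line_interval R d (vertices (K e)) x (delta_mx 0 j)).
have /choice[Es HE] := H.
exists (flatten [seq Es e | e <- enum 'I_m]) => s sE.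
have [[e He]|NE] := pselect (exists e, \forall t \near s, simplex (K e) (line x j t)).
  by left; exists e.
right.
have A e : \forall t \near s, ~ simplex (K e) (line x j t).
  have sEe : s \notin Es e.
    apply: contraNN sE => sEe; apply/flattenP; exists (Es e) => //.
    by apply: map_f; rewrite mem_enum.
  by have [He|//] := HE e s sEe; exfalso; apply: NE; exists e.
apply: filterS (@filter_forall _ _ _ (nbhs s) _ A) => t nt /subset_closure; rewrite -coverK => -[e]; exact: nt.
Qed.

(** The constant is uniform over lines: it is the sum over the simplices of the Lipschitz constants
    of the local polynomials on the cube. *)
Lemma Wh_line r v i : Wh Om K r v -> forall M, 0 <= M ->
  (forall x, closure Om x -> in_box M x) ->
  exists L, 0 <= L /\ forall x j s, regular_point x j s ->
    derivable (fun t : R => Defs.comp v i (line x j t)) s 1 /\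
    `|'D_1 (fun t : R => Defs.comp v i (line x j t)) s| <= L.
Proof.
move=> [cv [v0 /(_ i) /choice[p Hp]]] M M0 OmM.
have /choice[LB HLB] e := poly_le_lip_box M0 (Hp e).1.
exists (\sum_e (LB e).1); split; first by apply: sumr_ge0 => e _; case: (HLB e).
move=> x j s reg; set phi := (fun t => _).
have L0 : 0 <= \sum_e (LB e).1 by apply: sumr_ge0 => e _; case: (HLB e).
(* Agreement with [P] near [s] gives differentiability, and the local Lipschitz bound passes to the
   limit of the difference quotients. *)
suff [P [PE PL]] : exists P : {poly R}, (\forall t \near s, P.[t] = phi t) /\
    (\forall t \near s, `|phi t - phi s| <= (\sum_e (LB e).1) * `|t - s|).
  have dphi : derivable phi s 1.
    apply: (@near_eq_derivable _ _ _ (horner P) phi s 1 PE).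
    exact: derivable_horner.
  split => //; have := derivable_cvg_harmonic dphi => cphi.
  rewrite -(cvg_lim _ (cvg_norm cphi))//.
  apply: limr_le; first by apply: is_cvg_norm; exact: cvgP cphi.
  have : \forall n \near \oo, `|phi (s + @harmonic R n) - phi s| <=
      (\sum_e (LB e).1) * `|s + harmonic n - s|.
    have ch : (fun n => s + @harmonic R n) @ \oo --> s.
      rewrite -[X in _ --> X]addr0; apply: cvgD; first exact: cvg_cst.
      exact: cvg_harmonic.
    exact: ch PL.
  apply: filterS => n; rewrite addrAC subrr add0r normrM.
  have h0 : 0 < @harmonic R n by rewrite /= invr_gt0 ltr0n.
  by rewrite (gtr0_norm h0) gtr0_norm ?invr_gt0// ler_pdivrMl// mulrC.
have [[e He]|N] := reg.
  have [P PE] := poly_le_line x j (Hp e).1.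
  have phiE t : simplex (K e) (line x j t) -> phi t = P.[t].
    by move=> Kt; rewrite -PE; exact: (Hp e).2.
  have inM t : simplex (K e) (line x j t) -> in_box M (line x j t).
    by move=> Kt; apply: OmM; rewrite -coverK; exists e.
  exists P; split; first by apply: filterS He => t /phiE.
  have Ks := nbhs_singleton He.
  apply: filterS He => t Kt.
  rewrite (phiE _ Kt) (phiE _ Ks) -!PE.
  have [_ _ _ /(_ (line x j s) j (t - s) (inM _ Ks))] := HLB e.
  have -> : line x j s + (t - s) *: delta_mx 0 j = line x j t.
    by rewrite /= -addrA -scalerDl [s + _]addrC subrK.
  move=> /(_ (inM _ Kt)) /le_trans; apply; rewrite ler_wpM2r//.
  by rewrite (bigD1 e)//= lerDl sumr_ge0// => f _; case: (HLB f).
have phi0 t : ~ Om (line x j t) -> phi t = 0.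
  by move=> nO; rewrite /phi /Defs.comp v0// mxE.
exists 0; split; first by apply: filterS N => t /phi0 ->; rewrite horner0.
have Ns := nbhs_singleton N.
apply: filterS N => t /phi0 ->; rewrite phi0// subrr normr0 mulr_ge0//.
Qed.

Lemma Wh_lipschitz r v i : Wh Om K r v -> forall M, 0 <= M ->
  (forall x, closure Om x -> in_box M x) ->
  exists L, forall x j h, `|Defs.comp v i (x + h *: delta_mx 0 j) - Defs.comp v i x| <= L * `|h|.
Proof.
move=> Wv M M0 OmM; have [L [L0 HL]] := Wh_line i Wv M0 OmM.
exists L => x j h; have [E HE] := regular_point_exceptions x j.
have := @finite_exceptions_lipschitz _ (fun t : R => Defs.comp v i (line x j t)) L E _ _ h 0.
rewrite scale0r addr0 subr0; apply.
- move=> s; apply: (@continuous_comp _ _ _ (line x j) (Defs.comp v i)).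
    apply: cvgD; first exact: cvg_cst.
    by apply: cvgZl; exact: cvg_id.
  apply: (@continuous_comp _ _ _ v (fun M : 'rV_d => M 0 i)); last exact: coord_continuous.
  exact: Wv.1.
- by move=> s /HE; exact: HL.
Qed.

End mesh.

Lemma Wh_lip_supp n m (Om : set 'rV[R]_n.+1) (K : 'I_m -> 'I_n.+2 -> 'rV[R]_n.+1) r v i M :
  [set x | exists e, simplex (K e) x] = closure Om -> Wh Om K r v -> 0 <= M ->
  (forall x, closure Om x -> in_box M x) ->
  exists L B, lip_supp L M B (Defs.comp v i).
Proof.
move=> coverK Wv M0 OmM; have [L HL] := Wh_lipschitz coverK i Wv M0 OmM.
have L0 : 0 <= L by have := HL 0 ord0 1; rewrite normr1 mulr1; exact: le_trans.
have vM (x : 'rV[R]_n.+1) j : M < `|x 0 j| -> Defs.comp v i x = 0.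
  move=> xM; have [_ [v0 _]] := Wv; rewrite /Defs.comp v0 ?mxE// => /subset_closure/OmM/(_ j).
  by rewrite leNgt xM.
(* A shift by [2M + 1] along the first axis carries any point of the cube out of it, to where the
   field vanishes. *)
exists L, (L * (2 * M + 1)); split => // x.
have [xM|xM] := ltP M `|x 0 ord0|; first by rewrite (vM _ _ xM) normr0 mulr_ge0//; lra.
have := HL x ord0 (2 * M + 1); rewrite [Defs.comp v i (x + _)](vM _ ord0) ?sub0r ?normrN.
  by rewrite [`|2 * M + 1|]ger0_norm//; lra.
rewrite !mxE !eqxx mulr1.
move: xM; rewrite ler_norml => /andP[x1 x2].
by rewrite ger0_norm; lra.
Qed.

End finite_elements.

(** * The Poincare inequality *)

Section discrete_poincare.
Variable R : realType.
Local Notation mu := (@lebesgue_measure R).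

Lemma lip_supp_sum d (I : Type) (s : seq I) M (g : I -> 'rV[R]_d -> R) :
  (forall i, exists L B, lip_supp L M B (g i)) ->
  exists L B, lip_supp L M B (fun x => \sum_(i <- s) g i x).
Proof.
move=> gL; elim: s => [|i s [L1 [B1 IH]]].
  exists 0, 0; under eq_fun do rewrite big_nil; exact: lip_supp0.
have [L2 [B2 gi]] := gL i; exists (L2 + L1), (B2 + B1).
by under eq_fun do rewrite big_cons; exact: lip_suppD.
Qed.

Lemma in_box_box d (M : R) (x : 'rV[R]_d) : in_box M x -> box 0 M x = 1.
Proof. by move=> xM; rewrite /box big1// => i _; rewrite mxE subr0 xM. Qed.

Lemma box_line d (M : R) (x : 'rV[R]_d) j s :
  box 0 M (x + s *: delta_mx 0 j) <= (- x 0 j - M <= s <= - x 0 j + M)%R%:R.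
Proof.
have [h|h] := boolP (_ <= _ <= _); first exact: box_le1.
rewrite /box (bigD1 j)//= (_ : (_ <= M) = false) ?mul0r//.
apply: contraNF h; rewrite !mxE !eqxx/= mulr1 subr0 ler_norml => /andP[? ?].
by apply/andP; split; lra.
Qed.

(** Absorbing the discontinuous indicator leaves an integrand that is Lipschitz for fields of
    [Wh]. *)
Lemma dotv_indic d (Om : set 'rV[R]_d) (u w : 'rV[R]_d -> 'rV[R]_d) :
  (forall x, ~ Om x -> u x = 0) ->
  (fun x => dotv (u x) (w x) * \1_Om x) = (fun x => dotv (u x) (w x)).
Proof.
move=> u0; apply/funext => x; have [Omx|Omx] := pselect (Om x).
  by rewrite indicE mem_set// mulr1.
rewrite indicE memNset// mulr0 /dotv big1// => i _.
by rewrite u0// mxE mul0r.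
Qed.

Lemma is_derive_sumsq n (phi : 'I_n -> R -> R) (s : R) :
  (forall i, derivable (phi i) s 1) ->
  is_derive s 1 (fun t => \sum_(i < n) phi i t * phi i t)
    (\sum_(i < n) 2 * (phi i s * 'D_1 (phi i) s)).
Proof.
move=> dphi.
rewrite (_ : (fun t => _) = \sum_(i < n) (phi i * phi i)); last first.
  by apply/funext => t; rewrite fct_sumE.
apply: is_derive_sum => i; have dp := derivableP (dphi i).
apply: is_derive_eq; rewrite /GRing.scale/=; ring.
Qed.

Section mesh.
Variables (n m r : nat) (Om : set 'rV[R]_n.+1) (K : 'I_m -> 'I_n.+2 -> 'rV[R]_n.+1).
Variable M : R.
Hypotheses (coverK : [set x | exists e, simplex (K e) x] = closure Om)
  (M0 : 0 <= M) (OmM : forall x, closure Om x -> in_box M x).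

Lemma Wh_dotv_lip_supp u w : Wh Om K r u -> Wh Om K r w ->
  exists L B, lip_supp L M B (fun x => dotv (u x) (w x)).
Proof.
move=> Wu Ww; apply: lip_supp_sum => i.
have [L1 [B1 ui]] := Wh_lip_supp i coverK Wu M0 OmM.
have [L2 [B2 wi]] := Wh_lip_supp i coverK Ww M0 OmM.
by eexists; eexists; exact: lip_suppM ui wi.
Qed.

Lemma Wh_dotv_integrable u w : Wh Om K r u -> Wh Om K r w ->
  ae_iintegrable (fun x => dotv (u x) (w x)).
Proof.
move=> Wu Ww; have [L [B uw]] := Wh_dotv_lip_supp Wu Ww.
exact: lip_supp_ae_iintegrable uw.
Qed.

Lemma gradip_ge0 (v : 'rV[R]_n.+1 -> 'rV[R]_n.+1) x : 0 <= gradip v v x.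
Proof. by do 2 (apply: sumr_ge0 => ? _); rewrite -expr2 sqr_ge0. Qed.

Lemma Wh_gradip_bound v : Wh Om K r v -> exists B, 0 <= B /\
  forall x, `|gradip v v x * \1_Om x| <= B * box 0 M x.
Proof.
move=> Wv.
have /choice[L HL] i : exists L, forall j x, `|pd (Defs.comp v i) j x| <= L.
  have [L [B [vL _ _]]] := Wh_lip_supp i coverK Wv M0 OmM.
  by eexists => j x; exact: pd_bound.
exists (\sum_(i < n.+1) \sum_(j < n.+1) L i * L i); split.
  by do 2 (apply: sumr_ge0 => ? _); rewrite -expr2 sqr_ge0.
move=> x; have [Omx|Omx] := pselect (Om x); last first.
  rewrite indicE memNset// mulr0 normr0 mulr_ge0 ?box_ge0//.
  by do 2 (apply: sumr_ge0 => ? _); rewrite -expr2 sqr_ge0.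
rewrite indicE mem_set// mulr1 ger0_norm ?gradip_ge0//.
rewrite in_box_box ?mulr1; last by apply: OmM; exact: subset_closure.
apply: ler_sum => i _; apply: ler_sum => j _.
by rewrite -[leLHS]ger0_norm -?expr2 ?sqr_ge0// expr2 normrM ler_pM.
Qed.

Lemma Wh_poincare v : Wh Om K r v -> nsqO Om v <= 4 * M ^+ 2 * gnsqO Om v.
Proof.
move=> Wv; have [v0 vL] : (forall x, ~ Om x -> v x = 0) /\
    exists L B, lip_supp L M B (fun x => dotv (v x) (v x)).
  by split; [exact: Wv.2.1|exact: Wh_dotv_lip_supp].
rewrite /nsqO /ipO /gnsqO /gipO /intO dotv_indic//.
set g := (fun x => dotv _ _); set h := (fun x => gradip _ _ _ * _).
have [L [Bg gLB]] := vL; have [gL _ _] := gLB.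
have gB := lip_supp_box gLB.
have [Bh [Bh0 hB]] := Wh_gradip_bound Wv.
have Bg0 : 0 <= Bg by have [_ _ /(_ 0)] := gLB; exact: le_trans.
have h0 x : 0 <= h x by rewrite mulr_ge0// ?gradip_ge0// indicE ler0n.
have M2 : 0 <= M ^+ 2 by exact: sqr_ge0.
apply: (@iint_last_le _ _ _ (fun x => (Bg + Bh) * box 0 M x)).
- by rewrite mulr_ge0.
- by apply: ae_iintegrableZ; exact: ae_iintegrable_box.
- by move=> x; apply: (le_trans (gB x)); rewrite ler_wpM2r ?box_ge0// lerDl.
- by move=> x; apply: (le_trans (hB x)); rewrite ler_wpM2r ?box_ge0// lerDr.
move=> x; set e := delta_mx 0 ord_max.
pose phi i (s : R) := Defs.comp v i (x + s *: e).
have [E HE] := regular_point_exceptions coverK x ord_max.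
have dphi s i : s \notin E -> derivable (phi i) s 1.
  have [L' [_ H]] := Wh_line coverK i Wv M0 OmM.
  by move=> /HE /H [].
have pdphi s i : 'D_1 (phi i) s = pd (Defs.comp v i) ord_max (x + s *: e).
  by rewrite pd_line.
have dg s : s \notin E -> is_derive s 1 (fun t => g (x + t *: e))
    (\sum_i 2 * (phi i s * 'D_1 (phi i) s)).
  by move=> sE; apply: (@is_derive_sumsq _ phi) => i; exact: dphi.
suff : 2^-1 * Rintegral mu setT (fun s => g (x + s *: e)) <=
    Rintegral mu setT (fun s => 2 * M ^+ 2 * h (x + s *: e)).
  by rewrite Rintegral_lowerZ; lra.
(* Along the last axis, the last coordinate is [s + x 0 ord_max], so the parameters in the cube form
   an interval centred at [- x 0 ord_max]. *)
apply: (@poincare_line _ _ _ L (- x 0 ord_max) M (Bg + 2 * M ^+ 2 * Bh) E) => //.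
- move=> s t; have := gL (x + t *: e) ord_max (s - t).
  by rewrite -addrA -scalerDl [t + _]addrC subrK.
- move=> s; apply: (le_trans (gB _)); apply: ler_pM; rewrite ?box_ge0//.
    by rewrite lerDl !mulr_ge0.
  exact: box_line.
- move=> s; rewrite normrM ger0_norm ?mulr_ge0//.
  apply: (@le_trans _ _ (2 * M ^+ 2 * (Bh * box 0 M (x + s *: e)))).
    by apply: ler_wpM2l (hB _); rewrite mulr_ge0.
  rewrite mulrA; apply: ler_pM; rewrite ?box_ge0 ?mulr_ge0 ?lerDr//.
  exact: box_line.
- by move=> s /dg [].
move=> s sE; have [_ ->] := dg s sE.
(* Outside [Om] the field is 0: the term with the derivative drops out whatever its value, and the
   remaining terms have the right sign. *)
have [Omx|Omx] := pselect (Om (x + s *: e)); last first.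
  rewrite big1 => [|i _]; last by rewrite /phi /Defs.comp v0// mxE mul0r mulr0.
  rewrite mulr0 oppr0 sub0r (le_trans _ (mulr_ge0 _ (h0 _)))//; last by rewrite mulr_ge0.
  by rewrite oppr_le0 mulr_ge0//; apply: sumr_ge0 => i _; rewrite -expr2 sqr_ge0.
have sM : (s + x 0 ord_max) ^+ 2 <= M ^+ 2.
  have := OmM (subset_closure Omx) ord_max.
  rewrite !mxE !eqxx/= mulr1 addrC => sM.
  by move: sM; rewrite ler_norml => /andP[? ?]; nra.
rewrite opprK /h indicE mem_set// mulr1 /g /dotv !mulr_sumr -sumrN -sumrB.
apply: ler_sum => i _.
rewrite pdphi; set D := pd _ _ _; set p := phi i s.
(* With [y = s + x 0 ord_max], expanding [(p + 2yD)^2 >= 0] gives [- 2ypD - p^2/2 <= 2y^2 D^2], and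
   [y^2 <= M^2]. Afterwards [D^2] is one summand of the squared gradient. *)
apply: (@le_trans _ _ (2 * M ^+ 2 * D ^+ 2)).
  rewrite -[v _ 0 i]/p.
  have := ler_wpM2r (sqr_ge0 D) sM; have := sqr_ge0 (p + 2 * (s + x 0 ord_max) * D).
  by nra.
rewrite ler_wpM2l ?mulr_ge0// (bigD1 ord_max)//= expr2 lerDl.
by apply: sumr_ge0 => j _; rewrite -expr2 sqr_ge0.
Qed.

(** An open set contains a small cube, whose measure is explicit; the large cube dominates both
    indicators. Half the radius keeps the closed cube inside the open ball. *)
Lemma measO_gt0 : open Om -> Om !=set0 -> 0 < measO Om.
Proof.
move=> oOm [a Oma].
have /nbhs_ballP[e /= e0 aOm] : nbhs a Om by exact: open_nbhs_nbhs.
have e2 : 0 < e / 2 by rewrite divr_gt0.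
apply: (@lt_le_trans _ _ (iint (box a (e / 2)))).
  by rewrite iint_box ?ltW// exprn_gt0// mulr_gt0.
have D1 x : box a (e / 2) x <= 1 * \1_Om x.
  rewrite mul1r indicE; have [Omx|/negP Omx] := boolP (x \in Om).
    exact: box_le1.
  rewrite boxE; have [/forallP xa|//] := boolP [forall i, `|x 0 i - a 0 i| <= e / 2].
  exfalso; apply: Omx; rewrite inE; apply: aOm; split => // i j.
  rewrite [i]ord1 /ball/= distrC; apply: (le_lt_trans (xa j)).
  by rewrite ltr_pdivrMr// mulr_natr mulr2n ltrDl.
have OmB x : 1 * \1_Om x <= box 0 M x.
  rewrite mul1r indicE; have [/set_mem Omx|_] := boolP (x \in Om); last exact: box_ge0.
  by rewrite in_box_box//; apply: OmM; exact: subset_closure.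
apply: (@iint_le _ _ (box 0 M)) => //.
- exact: ae_iintegrable_box.
- by move=> x; rewrite ger0_norm ?box_ge0// (le_trans (D1 x)).
- by move=> x; rewrite ger0_norm// mul1r indicE.
Qed.

End mesh.

End discrete_poincare.

(** * Energy estimate *)

Section energy.
Variable R : realType.

Lemma iint_lin2 d (s t : R) (f g : 'rV[R]_d -> R) :
  ae_iintegrable f -> ae_iintegrable g ->
  ae_iintegrable (fun x => s * f x + t * g x) /\
  iint (fun x => s * f x + t * g x) = s * iint f + t * iint g.
Proof.
move=> fi gi.
have [i ->] := ae_iintegrableD (ae_iintegrableZ s fi) (ae_iintegrableZ t gi).
by split; rewrite // !iintZ.
Qed.

Lemma dotvZBl d (c : R) (a b w : 'rV[R]_d) :
  dotv (c *: (a - b)) w = c * dotv a w + - c * dotv b w.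
Proof.
rewrite /dotv !mulr_sumr -big_split/=; apply: eq_bigr => i _.
by rewrite !mxE; ring.
Qed.

(** The unit coefficients give the expansion the nested two-term shape that [iint_lin2]
    integrates. *)
Lemma dotvBB d (a b : 'rV[R]_d) :
  dotv (a - b) (a - b) = 1 * dotv a a + 1 * (- 2 * dotv b a + 1 * dotv b b).
Proof.
rewrite /dotv !mulr_sumr -big_split/= mulr_sumr -big_split/=.
by apply: eq_bigr => i _; rewrite !mxE; ring.
Qed.

Lemma L2vecO_integrable d (Om : set 'rV[R]_d) f : L2vecO Om f ->
  ae_iintegrable (fun x => dotv (f x) (f x) * \1_Om x).
Proof.
move=> fL2; rewrite (_ : (fun x => _) =
  fun x => \sum_i Defs.comp f i x ^+ 2 * \1_Om x); last first.
  by apply/funext => x; rewrite /dotv mulr_suml.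
by apply: ae_iintegrable_sum => i; apply: ae_iintegrableW; exact: (fL2 i).2.
Qed.

(* Only domination is used: the product [f . w] need not be measurable for the
   iterated integral. *)
Lemma ipO_young d (Om : set 'rV[R]_d) (f w : 'rV[R]_d -> 'rV[R]_d) (c : R) :
  0 < c -> L2vecO Om f -> (forall x, ~ Om x -> w x = 0) ->
  ae_iintegrable (fun x => dotv (w x) (w x)) ->
  2 * ipO Om f w <= c * nsqO Om f + c^-1 * nsqO Om w.
Proof.
move=> c0 fL2 w0 wi.
have fi := L2vecO_integrable fL2.
rewrite -(dotv_indic _ w0) in wi.
have [iD ED] := iint_lin2 (c / 2) (c^-1 / 2) fi wi.
have : `|ipO Om f w| <= iint (fun x => c / 2 * (dotv (f x) (f x) * \1_Om x) +
    c^-1 / 2 * (dotv (w x) (w x) * \1_Om x)).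
  apply: norm_iint_le => // x.
  rewrite normrM [`|\1_Om x|]ger0_norm ?indicE// !mulrA -mulrDl ler_wpM2r//.
  rewrite /dotv !mulr_sumr -big_split/= (le_trans (ler_norm_sum _ _ _))//.
  apply: ler_sum => i _.
  rewrite ler_norml; set a := f x 0 i; set b := w x 0 i.
  have ci0 : 0 < c^-1 by rewrite invr_gt0.
  (* Completing the square; [t = 1] and [t = -1] make the last term vanish and bound the product
     from both sides. *)
  have E t : c / 2 * (a * a) + c^-1 / 2 * (b * b) + t * (a * b) =
      c^-1 / 2 * (c * a + t * b) ^+ 2 + c^-1 / 2 * (1 - t ^+ 2) * b ^+ 2.
    by field; rewrite gt_eqF.
  have P t : 0 <= c^-1 / 2 * (c * a + t * b) ^+ 2.
    by rewrite mulr_ge0 ?sqr_ge0// divr_ge0// ltW.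
  have := E 1; have := E (-1); have := P 1; have := P (-1).
  by rewrite sqrrN expr1n subrr !mulr0 !mul0r !addr0 => ? ? ? ?; apply/andP; split; lra.
rewrite ED ler_norml => /andP[_].
by rewrite /nsqO /ipO /intO; lra.
Qed.

End energy.

Lemma telescoping_bound (R : realType) (N : nat) (a x y z : nat -> R) :
  (forall n, (n < N)%N -> a n.+1 + x n + y n <= z n + a n) ->
  a N + \sum_(n < N) x n + \sum_(n < N) y n <= \sum_(n < N) z n + a 0%N.
Proof.
elim: N => [|N IH] H; first by rewrite !big_ord0; lra.
have := IH (fun n nN => H n (ltnW nN)); have := H N (ltnSn N).
by rewrite !big_ord_recr/=; lra.
Qed.

Theorem theorem5p1 (R : realType) (d : nat) (Hd : d = 2%N \/ d = 3%N)
  (Om : set 'rV[R]_d) (HOm : bounded_domain Om)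
  (r : nat) (Hr : (2 <= r)%N)
  (m : nat) (K : 'I_m -> 'I_d.+1 -> 'rV[R]_d) (HK : triangulation Om K)
  (Hinfsup : inf_sup Om (Wh Om K r) (Qh Om K r))
  (nu mu tau : R) (Hnu : 0 < nu) (Hmu : 0 < mu) (Htau : 0 < tau) :
  exists C : R,
  forall (f : R -> 'rV[R]_d -> 'rV[R]_d), (forall t, L2vecO Om (f t)) ->
  forall (dt : R) (N : nat) (v : nat -> 'rV[R]_d -> 'rV[R]_d)
         (q : nat -> 'rV[R]_d -> R) (k : nat -> R),
  0 < dt ->
  Wh Om K r (v 0%N) ->
  (forall n : nat, (n < N)%N ->
     Wh Om K r (v n.+1) /\ Qh Om K r (q n.+1) /\
     (forall w, Wh Om K r w ->
        ipO Om (fun x => dt^-1 *: (v n.+1 x - v n x)) w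
        + (nu + mu * tau * k n) * gipO Om (v n.+1) w
        + btri Om (v n) (v n.+1) w
        - intO Om (fun x => divg w x * q n.+1 x)
        = ipO Om (f (n.+1%:R * dt)) w) /\
     (forall p, Qh Om K r p -> intO Om (fun x => divg (v n.+1) x * p x) = 0) /\
     ((k n.+1 - k n) / dt + Num.sqrt 2 / 2 * tau^-1 * k n.+1
        = (measO Om)^-1 * intO Om (fun x => mu * tau * k n * gradip (v n.+1) (v n.+1) x))) ->
  nsqO Om (v N) + 2 * measO Om * k N
  + dt * (\sum_(n < N) (nu * gnsqO Om (v n.+1) + Num.sqrt 2 * tau^-1 * measO Om * k n.+1))
  + \sum_(n < N) nsqO Om (fun x => v n.+1 x - v n x)
  <= \sum_(n < N) C * dt * nsqO Om (f (n.+1%:R * dt))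
     + nsqO Om (v 0%N) + 2 * measO Om * k 0%N.
Proof.
have [d' Ed] : exists d', d = d'.+1 by case: Hd => ->; [exists 1%N|exists 2%N].
subst d; clear Hd Hinfsup Hr.
have [oOm [_ [nOm bOm]]] := HOm; have [_ [coverK _]] := HK.
have [M [M0 OmM]] := bounded_closure_in_box bOm.
have M0' := ltW M0.
have meas0 : 0 < measO Om by exact: measO_gt0 OmM oOm nOm.
pose P := 4 * M ^+ 2.
have P0 : 0 < P by rewrite mulr_gt0// exprn_gt0.
(* [P] is the Poincare constant. The witness depends on [Om] and [nu] only and is fixed before the
   data, the time step and [N]. *)
exists (P / nu) => f fL2 dt N v q k dt0 Wv0 step.
have Wv n : (n <= N)%N -> Wh Om K r (v n).
  by case: n => [//|n] nN; exact: (step n nN).1.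
pose a n := nsqO Om (v n) + 2 * measO Om * k n.
pose x n := dt * (nu * gnsqO Om (v n.+1) + Num.sqrt 2 * tau^-1 * measO Om * k n.+1).
pose y n := nsqO Om (fun x => v n.+1 x - v n x).
pose z n := P / nu * dt * nsqO Om (f (n.+1%:R * dt)).
rewrite mulr_sumr -[leRHS]addrA.
apply: (@telescoping_bound _ N a x y z) => n nN.
rewrite {}/a {}/x {}/y {}/z.
have Wn := Wv n (ltnW nN); have Wn1 := Wv n.+1 nN.
have [_ [Qq [mom [div0 keq]]]] := step n nN.
have v0 := Wn1.2.1.
set G := gnsqO _ _; set m0 := measO Om in meas0 *.
set A := nsqO Om (v n.+1); set B := nsqO Om (v n).
pose X := ipO Om (v n) (v n.+1).
have iA := Wh_dotv_integrable coverK M0' OmM Wn1 Wn1.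
have iB := Wh_dotv_integrable coverK M0' OmM Wn Wn.
have iX := Wh_dotv_integrable coverK M0' OmM Wn Wn1.
have ipE (u w : 'rV[R]_d'.+1 -> 'rV[R]_d'.+1) : (forall x, ~ Om x -> u x = 0) ->
    ipO Om u w = iint (fun x => dotv (u x) (w x)).
  by move=> u0; rewrite /ipO /intO dotv_indic.
have vn0 := Wn.2.1.
have diff0 x : ~ Om x -> v n.+1 x - v n x = 0.
  by move=> nx; rewrite v0// vn0// subrr.
have Etime : ipO Om (fun x => dt^-1 *: (v n.+1 x - v n x)) (v n.+1) = dt^-1 * (A - X).
  rewrite ipE => [|x /diff0 ->]; last by rewrite scaler0.
  rewrite (_ : (fun x => _) = fun x => dt^-1 * dotv (v n.+1 x) (v n.+1 x) +
    - dt^-1 * dotv (v n x) (v n.+1 x)); last by apply/funext => x; exact: dotvZBl.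
  rewrite (iint_lin2 _ _ iA iX).2 /A /X /nsqO !ipE//; ring.
have Ediff : nsqO Om (fun x => v n.+1 x - v n x) = A - 2 * X + B.
  rewrite /nsqO ipE// (_ : (fun x => _) = fun x => 1 * dotv (v n.+1 x) (v n.+1 x) +
    1 * (- 2 * dotv (v n x) (v n.+1 x) + 1 * dotv (v n x) (v n x))); last first.
    by apply/funext => x; exact: dotvBB.
  have [iXB EXB] := iint_lin2 (- 2) 1 iX iB.
  rewrite (iint_lin2 1 1 iA iXB).2 EXB /A /B /X /nsqO !ipE//; ring.
(* With [v n.+1] as test function the two halves of [btri] cancel, and the pressure term is the
   divergence constraint tested with [q n.+1]. *)
have := mom _ Wn1; rewrite Etime /btri subrr addr0 div0// subr0 -[gipO _ _ _]/G => {}mom.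
have {}keq : (k n.+1 - k n) / dt + Num.sqrt 2 / 2 * tau^-1 * k n.+1 =
    m0^-1 * (mu * tau * k n * G).
  rewrite keq /G /gnsqO /gipO /intO -iintZ; congr (_ * iint _).
  by apply/funext => x; rewrite mulrA.
(* The weight [P / nu] is chosen so that, by the Poincare inequality, the term in [v n.+1] is at
   most [nu * G]. *)
have young := @ipO_young _ _ Om (f (n.+1%:R * dt)) (v n.+1) (P / nu)
  (divr_gt0 P0 Hnu) (fL2 _) v0 iA.
have poin := Wh_poincare coverK M0' OmM Wn1.
rewrite -/A -/G -/P in young poin; rewrite Ediff.
set F := nsqO Om (f _) in young *; set I := ipO Om (f _) _ in young mom.
have nuA : (P / nu)^-1 * A <= nu * G.
  by rewrite invf_div mulrAC ler_pdivrMr// -mulrA ler_wpM2l ?(ltW Hnu)// mulrC.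
have mom' : 2 * (A - X) + 2 * dt * ((nu + mu * tau * k n) * G) = 2 * dt * I.
  by rewrite -mom; field; rewrite gt_eqF.
(* Multiplication by [2 * m0 * dt] makes the production term equal to the turbulent dissipation in
   [mom']. *)
have keq' : 2 * m0 * (k n.+1 - k n) + dt * (Num.sqrt 2 * tau^-1 * m0 * k n.+1) =
    2 * dt * (mu * tau * k n * G).
  have := congr1 (fun t => 2 * m0 * dt * t) keq.
  rewrite mulrDr (_ : 2 * m0 * dt * ((k n.+1 - k n) / dt) = 2 * m0 * (k n.+1 - k n));
    last by field; rewrite gt_eqF.
  rewrite (_ : 2 * m0 * dt * (m0^-1 * _) = 2 * dt * (mu * tau * k n * G));
    last by field; rewrite gt_eqF.
  by move=> <-; field; rewrite gt_eqF.
have young' : dt * (2 * I) <= dt * (P / nu * F + nu * G).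
  by rewrite ler_wpM2l ?(ltW dt0)//; apply: (le_trans young); rewrite lerD2l.
(* Adding [mom'] and [keq'] cancels the turbulent terms; half of the viscous term [2 * dt * nu * G]
   absorbs the forcing and the other half remains in the estimate. *)
lra.
Qed.
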